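(* Let $(\mathfrak a,B)$ be a pair over $\mathbf{R}$ satisfying condition (Q), with base change $(\mathfrak a',B')$ to $\mathbf{C}$, and let $X$ be an irreducible admissible infinitesimally unitary $(\mathfrak a',B')$-module over $\mathbf{C}$. Then $\mathrm{FS}_{\mathbf{R}}(X)\neq0$ if and only if $X$ carries a non-zero invariant bilinear form. In this case $X$ is real (resp. quaternionic) if and only if this form is symmetric (resp. anti-symmetric).
   Context: A pair $(\mathfrak a,B)$ over a field $F$ of characteristic $0$ consists of a reductive linear algebraic group $B$ over $F$ (not necessarily connected; connected components assumed geometrically connected), a finite-dimensional Lie algebra $\mathfrak a$ over $F$, a monomorphism $\mathfrak b=\mathrm{Lie}(B)\to\mathfrak a$, and an action of $B$ on $\mathfrak a$ whose differential is the action of $\mathfrak b$. An $(\mathfrak a,B)$-module is a locally finite rational $B$-module over $F$ with a $B$-equivariant action of $\mathfrak a$ whose restriction to $\mathfrak b$ is the derivative of the $B$-action. It is admissible if $\dim_F\mathrm{Hom}_B(V,X)<\infty$ for every finite-dimensional rational $B$-module $V$. Condition (Q): there is a finite subgroup $B_0\subseteq B$ such that $B_0\to\pi_0(B\otimes_F\overline F)$ is surjective. Let $\tau$ be complex conjugation and $\overline X=X\otimes_{\mathbf{C},\tau}\mathbf{C}$, with its natural $(\mathfrak a',B')$-module structure determined by the real form $(\mathfrak a,B)$. A Hermitian form on $X$ is an $(\mathfrak a',B')$-equivariant $\mathbf{C}$-linear map $h:X\otimes_{\mathbf{C}}\overline X\to\mathbf{C}$ (trivial action on $\mathbf{C}$)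 which is conjugate symmetric; $X$ is infinitesimally unitary if it admits a positive definite one. Let $Y=\mathrm{Res}_{\mathbf{C}/\mathbf{R}}X$ be $X$ viewed as an $(\mathfrak a,B)$-module over $\mathbf{R}$. $\mathrm{FS}_{\mathbf{R}}(X)=1$ if $\mathrm{End}_{\mathfrak a,B}(Y)=\mathbf{R}^{2\times2}$ ($X$ is real), $\mathrm{FS}_{\mathbf{R}}(X)=0$ if $\mathrm{End}_{\mathfrak a,B}(Y)=\mathbf{C}$, and $\mathrm{FS}_{\mathbf{R}}(X)=-1$ if $\mathrm{End}_{\mathfrak a,B}(Y)$ is a quaternion division algebra over $\mathbf{R}$ ($X$ is quaternionic). An invariant bilinear form is an $(\mathfrak a',B')$-equivariant $\mathbf{C}$-linear map $X\otimes_{\mathbf{C}}X\to\mathbf{C}$. *)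

(* Defs.v *)
(* MathComp with classical logic: [R : realType] stands for the real numbers
   and [R[i]] for the complex numbers. *)
From HB Require Import structures.
From mathcomp Require Import all_boot all_order all_algebra.
From mathcomp Require Import complex mpoly.
From mathcomp Require Import boolp classical_sets cardinality reals.

Set Implicit Arguments.
Unset Strict Implicit.
Unset Printing Implicit Defensive.

Import Order.TTheory GRing.Theory Num.Theory.
Local Open Scope classical_set_scope.
Local Open Scope ring_scope.
Local Open Scope complex_scope.

(* A linear algebraic group over K is given by its set B of points over an
   algebraically closed extension C of K: a subgroup of GL_n(C) cut out by
   polynomials over K.  As the characteristic is 0, group schemes are reduced
   and this datum determines the group scheme over K.
   The coordinate ring K[GL_n] is K[x_ij, 1/det], presented by polynomials in
   n * n + 1 variables: the n * n entries (ordered by [mxvec]) and 1/det. *)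
Notation regfun K n := {mpoly K[n * n + 1]}.

Definition glcoord (K : fieldType) (n : nat) (g : 'M[K]_n) (k : 'I_(n * n + 1)) : K :=
  row_mx (mxvec g) ((\det g)^-1)%:M 0 k.

(* The derivative at 1 in the direction X of the coordinates above. *)
Definition gltangent (K : fieldType) (n : nat) (X : 'M[K]_n) (k : 'I_(n * n + 1)) : K :=
  row_mx (mxvec X) (- \tr X)%:M 0 k.

Definition dif (K : fieldType) (n : nat) (p : regfun K n) (X : 'M[K]_n) : K :=
  \sum_k (p^`M(k)).@[glcoord 1%:M] * gltangent X k.

Section AlgebraicGroups.
Context (K C : fieldType) (iota : {rmorphism K -> C}) (n : nat).
Implicit Types (A B H U : set 'M[C]_n).

Definition ev (p : regfun K n) (g : 'M[C]_n) : C := mmap iota (glcoord g) p.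

Definition closed_over A : Prop :=
  exists S : set (regfun K n),
    A = [set g | g \in unitmx /\ forall p, S p -> ev p g = 0].

Definition connected_over A : Prop :=
  ~ exists A1 A2,
      [/\ closed_over A1, closed_over A2, A `<=` A1 `|` A2,
          A `&` A1 `&` A2 = set0 & A `&` A1 !=set0 /\ A `&` A2 !=set0].

(* Connected components for the topology whose closed sets are the zero sets
   of polynomials over K; those of B correspond to the connected components of
   the scheme B over K. *)
Definition component_over A B : Prop :=
  [/\ A !=set0, A `<=` B, connected_over A &
      forall A', A `<=` A' -> A' `<=` B -> connected_over A' -> A' = A].

Definition is_subgroup B : Prop :=
  [/\ B `<=` [set g | g \in unitmx], B 1%:M,
      forall g h, B g -> B h -> B (g *m h) &
      forall g, B g -> B (invmx g)].

Definition algebraic_group_over B : Prop := is_subgroup B /\ closed_over B.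

(* The Lie algebra over K, as a subspace of gl_n(K). *)
Definition lie_of B : set 'M[K]_n :=
  [set X | forall p, (forall g, B g -> ev p g = 0) -> dif p X = 0].

End AlgebraicGroups.

Section Geometric.
Context (C : fieldType) (n : nat).
Implicit Types (B U : set 'M[C]_n).

Definition normal_in U B : Prop :=
  U `<=` B /\ forall g u, B g -> U u -> U (g *m u *m invmx g).

Definition unipotent_group U : Prop :=
  forall u, U u -> exists k, (u - 1%:M) ^+ k = 0.

(* The unipotent radical (the largest closed connected normal unipotent
   subgroup) is trivial; [C] is meant to be algebraically closed. *)
Definition reductive B : Prop :=
  forall U, algebraic_group_over (idfun : C -> C) U ->
    connected_over (idfun : C -> C) U ->
    normal_in U B -> unipotent_group U -> U = [set 1%:M].

End Geometric.

Section Representations.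
Context (K C : fieldType) (iota : {rmorphism K -> C}) (n : nat).
(* [W] is the scalar extension of [V] along [iota], with [j : V -> W] the
   canonical map; a representation over K of the group of points B is an
   action of B on [W] whose matrix coefficients with respect to [V] lie in
   K[B].  For K = C one takes for [j] the identity. *)
Context (V : lmodType K) (W : lmodType C) (j : V -> W) (B : set 'M[C]_n).

(* The orbit map of [v] is g |-> \sum_i f_i(g) v_i, for s the list of the
   (f_i, v_i), i.e., the coaction V -> V (x) K[B] sends v to
   \sum_i v_i (x) f_i. *)
Definition orbit_map (rho : 'M[C]_n -> W -> W) (v : V) (s : seq (regfun K n * V)) :=
  forall g, B g -> rho g (j v) = \sum_(fv <- s) ev iota fv.1 g *: j fv.2.

Definition rational_rep (rho : 'M[C]_n -> W -> W) : Prop :=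
  [/\ forall g, B g -> linear (rho g),
      forall w, rho 1%:M w = w,
      forall g h, B g -> B h -> forall w, rho (g *m h) w = rho g (rho h w) &
      (* local finiteness and rationality *)
      forall v, exists s, orbit_map rho v s].

(* [drho] is, on Lie(B), the derivative of [rho]. *)
Definition is_differential (rho : 'M[C]_n -> W -> W) (drho : 'M[K]_n -> V -> V) : Prop :=
  forall X, lie_of iota B X -> forall v s, orbit_map rho v s ->
    drho X v = \sum_(fv <- s) dif fv.1 X *: fv.2.

End Representations.

Section Lie.
Context (K : fieldType) (L : lmodType K) (br : L -> L -> L).

Definition is_lie_bracket : Prop :=
  [/\ forall x, linear (br x), forall y, linear (br^~ y), forall x, br x x = 0 &
      forall x y z, br x (br y z) + br y (br z x) + br z (br x y) = 0].

Definition lie_action (V : lmodType K) (act : L -> V -> V) : Prop :=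
  [/\ forall x, linear (act x), forall v, linear (act^~ v) &
      forall x y v, act (br x y) v = act x (act y v) - act y (act x v)].

(* An injective homomorphism of Lie algebras b -> L, for a Lie subalgebra b of
   gl_n; the values of [i] outside b are irrelevant. *)
Definition lie_mono (n : nat) (b : set 'M[K]_n) (i : 'M[K]_n -> L) : Prop :=
  [/\ forall c X Y, b X -> b Y -> i (c *: X + Y) = c *: i X + i Y,
      forall X Y, b X -> b Y -> i (X *m Y - Y *m X) = br (i X) (i Y) &
      forall X, b X -> i X = 0 -> X = 0].

End Lie.

(* C (x)_R V, the pair (x, y) standing for 1 (x) x + i (x) y. *)
Definition cplx (R : realType) (V : lmodType R) : Type := (V * V)%type.

Section Complexification.
Context (R : realType) (V : lmodType R).

HB.instance Definition _ := GRing.Zmodule.copy (cplx V) (V * V)%type.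

Definition cplx_scale (c : R[i]) (w : cplx V) : cplx V :=
  (complex.Re c *: w.1 - complex.Im c *: w.2,
   complex.Re c *: w.2 + complex.Im c *: w.1).

Lemma cplx_scaleA c d w : cplx_scale c (cplx_scale d w) = cplx_scale (c * d) w.
Proof.
case: c d w => [a b] [a' b'] [x y]; rewrite /cplx_scale /=; congr (_, _);
  rewrite !(scalerBr, scalerDr, scalerA, scalerBl, scalerDl).
- by rewrite !opprD (addrC (- (_ *: y))) addrACA.
- by rewrite (addrC ((b * a') *: x)) addrACA.
Qed.

Lemma cplx_scale1 w : cplx_scale 1 w = w.
Proof. by case: w => x y; rewrite /cplx_scale /= !scale1r !scale0r subr0 addr0. Qed.

Lemma cplx_scaleDr : right_distributive cplx_scale +%R.
Proof.
move=> [a b] [x y] [x' y']; rewrite /cplx_scale /=; congr (_, _).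
- by rewrite !scalerDr opprD addrACA.
- by rewrite !scalerDr addrACA.
Qed.

Lemma cplx_scaleDl w : {morph cplx_scale^~ w : c d / c + d}.
Proof.
case: w => x y [a b] [a' b']; rewrite /cplx_scale /=; congr (_, _).
- by rewrite !scalerDl opprD addrACA.
- by rewrite !scalerDl addrACA.
Qed.

HB.instance Definition _ := GRing.Zmodule_isLmodule.Build R[i] (cplx V)
  cplx_scaleA cplx_scale1 cplx_scaleDr cplx_scaleDl.

Definition inC (v : V) : cplx V := (v, 0).
Definition conjC_vec (w : cplx V) : cplx V := (w.1, - w.2).

End Complexification.

(* The complex bilinear extension of an R-bilinear map. *)
Definition cbilin (R : realType) (U V W : lmodType R) (f : U -> V -> W)
    (z : cplx U) (w : cplx V) : cplx W :=
  (f z.1 w.1 - f z.2 w.2, f z.1 w.2 + f z.2 w.1).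

(* The complex linear extension of an R-linear map. *)
Definition clin (R : realType) (V W : lmodType R) (f : V -> W) (w : cplx V) : cplx W :=
  (f w.1, f w.2).

Definition cmxlin (R : realType) (n : nat) (V : lmodType R) (f : 'M[R]_n -> V)
    (X : 'M[R[i]]_n) : cplx V :=
  (f (map_mx (@complex.Re R) X), f (map_mx (@complex.Im R) X)).

Definition conj_mx (R : realType) (n : nat) (g : 'M[R[i]]_n) : 'M[R[i]]_n :=
  map_mx conjc g.

(* The base change to C of the pair (a, B) has Lie algebra [cplx a], with
   bracket [cbilin (pbr P)], and group B' given by the same set of complex
   points, considered over C; the action of B' on [cplx a] is [pAd P] and the
   inclusion of Lie(B') is [cmxlin (pincl P)]. *)
Record lie_pair (R : realType) := Pair {
  psize : nat;
  pgrp : set 'M[R[i]]_psize;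
  pgrp_alg : algebraic_group_over (real_complex R) pgrp;
  pgrp_reductive : reductive pgrp;
  (* the connected components are geometrically connected *)
  pgrp_geom : forall A, component_over (real_complex R) A pgrp ->
    connected_over (idfun : R[i] -> R[i]) A;
  plie : vectType R;
  pbr : plie -> plie -> plie;
  pbr_lie : is_lie_bracket pbr;
  pincl : 'M[R]_psize -> plie;
  pincl_mono : lie_mono pbr (lie_of (real_complex R) pgrp) pincl;
  pAd : 'M[R[i]]_psize -> cplx plie -> cplx plie;
  pAd_rational : rational_rep (real_complex R) (@inC R plie) pgrp pAd;
  pAd_aut : forall g, pgrp g -> forall x y,
    pAd g (cbilin pbr x y) = cbilin pbr (pAd g x) (pAd g y);
  pAd_dif : is_differential (real_complex R) (@inC R plie) pgrp pAd
    (fun X => pbr (pincl X)) }.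

Arguments plie {R} l.
Arguments pgrp {R} l _.
Arguments pbr {R} l _ _.
Arguments pincl {R} l _.
Arguments pAd {R} l _ _.

Definition conditionQ (R : realType) (P : lie_pair R) : Prop :=
  exists B0 : set 'M[R[i]]_(psize P),
    [/\ algebraic_group_over (real_complex R) B0, finite_set B0, B0 `<=` pgrp P &
        forall A, component_over (idfun : R[i] -> R[i]) A (pgrp P) -> A `&` B0 !=set0].

(* (a, B)-modules over R. *)
Record rmodule (R : realType) (P : lie_pair R) := RModule {
  rcar :> lmodType R;
  rgrp : 'M[R[i]]_(psize P) -> cplx rcar -> cplx rcar;
  rlie : plie P -> rcar -> rcar;
  rgrp_rational : rational_rep (real_complex R) (@inC R rcar) (pgrp P) rgrp;
  rlie_action : lie_action (pbr P) rlie;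
  rlie_equiv : forall g, pgrp P g -> forall x w,
    rgrp g (cbilin rlie x w) = cbilin rlie (pAd P g x) (rgrp g w);
  rlie_dif : is_differential (real_complex R) (@inC R rcar) (pgrp P) rgrp
    (fun X => rlie (pincl P X)) }.

(* (a', B')-modules over C. *)
Record cmodule (R : realType) (P : lie_pair R) := CModule {
  ccar :> lmodType R[i];
  cgrp : 'M[R[i]]_(psize P) -> ccar -> ccar;
  clie : cplx (plie P) -> ccar -> ccar;
  cgrp_rational : rational_rep (idfun : R[i] -> R[i]) idfun (pgrp P) cgrp;
  clie_action : lie_action (cbilin (pbr P)) clie;
  clie_equiv : forall g, pgrp P g -> forall x v,
    cgrp g (clie x v) = clie (pAd P g x) (cgrp g v);
  clie_dif : is_differential (idfun : R[i] -> R[i]) idfun (pgrp P) cgrp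
    (fun X => clie (cmxlin (pincl P) X)) }.

Section Properties.
Context (R : realType) (P : lie_pair R).
Implicit Types X Y : cmodule P.

Definition submodule X (U : set X) : Prop :=
  [/\ U 0, forall (c : R[i]) u v, U u -> U v -> U (c *: u + v),
      forall g u, pgrp P g -> U u -> U (cgrp g u) &
      forall x u, U u -> U (clie x u)].

Definition irreducible X : Prop :=
  (exists v : X, v != 0) /\
  forall U : set X, submodule U -> U = [set 0] \/ U = setT.

Definition Bhom (V : lmodType R[i]) (sigma : 'M[R[i]]_(psize P) -> V -> V) X
    (phi : V -> X) : Prop :=
  linear phi /\ forall g, pgrp P g -> forall v, phi (sigma g v) = cgrp g (phi v).

Definition admissible X : Prop :=
  forall (V : vectType R[i]) (sigma : 'M[R[i]]_(psize P) -> V -> V),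
    rational_rep (idfun : R[i] -> R[i]) idfun (pgrp P) sigma ->
    exists (m : nat) (e : 'I_m -> V -> X),
      (forall k, Bhom sigma (e k)) /\
      forall phi : V -> X, Bhom sigma phi ->
        exists c : 'I_m -> R[i], forall v, phi v = \sum_k c k *: e k v.

(* Equivariant C-linear maps X (x) Y -> C, as bilinear maps on X x Y. *)
Definition invariant_pairing X Y (b : X -> Y -> R[i]) : Prop :=
  [/\ forall x (c : R[i]) y y', b x (c *: y + y') = c * b x y + b x y',
      forall y (c : R[i]) x x', b (c *: x + x') y = c * b x y + b x' y,
      forall g, pgrp P g -> forall x y, b (cgrp g x) (cgrp g y) = b x y &
      forall z x y, b (clie z x) y + b x (clie z y) = 0].

End Properties.

Section Scalars.
Context (K L : fieldType) (f : {rmorphism K -> L}) (n : nat).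
Implicit Types (p : regfun K n) (g X : 'M[K]_n).

Lemma glcoord_map g k : glcoord (map_mx f g) k = f (glcoord g k).
Proof.
rewrite /glcoord det_map_mx -fmorphV -map_scalar_mx -map_mxvec -map_row_mx.
by rewrite mxE.
Qed.

Lemma gltangent_map X k : gltangent (map_mx f X) k = f (gltangent X k).
Proof.
rewrite /gltangent trace_map_mx -rmorphN -map_scalar_mx -map_mxvec -map_row_mx.
by rewrite mxE.
Qed.

Lemma mmap_map_mpoly (C : fieldType) (k : {rmorphism L -> C}) h p :
  mmap k h (map_mpoly f p) = mmap (k \o f) h p.
Proof.
pose i := maxn (msize p) (msize (map_mpoly f p)).
rewrite (@mmapE _ _ _ _ _ _ i) ?leq_maxr// (@mmapE _ _ _ _ _ p i) ?leq_maxl//.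
by apply: eq_bigr => m _; rewrite mcoeff_map_mpoly.
Qed.

Lemma mderiv_map k p : (map_mpoly f p)^`M(k) = map_mpoly f (p^`M(k)).
Proof.
by apply/mpolyP => m; rewrite mcoeff_mderiv !mcoeff_map_mpoly mcoeff_mderiv raddfMn.
Qed.

Lemma mmap_rmorph (C : fieldType) (u : {rmorphism C -> K}) h (q : regfun C n) :
  f (mmap u h q) = mmap (f \o u) (f \o h) q.
Proof.
rewrite /mmap rmorph_sum; apply: eq_bigr => m _.
by rewrite rmorphM /mmap1 rmorph_prod; congr (_ * _); apply: eq_bigr => i _; rewrite rmorphXn.
Qed.

Lemma eq_mmap (C : fieldType) (u u' : C -> K) h h' (q : regfun C n) :
  u =1 u' -> h =1 h' -> mmap u h q = mmap u' h' q.
Proof.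
move=> eu eh; rewrite /mmap; apply: eq_bigr => m _; rewrite eu /mmap1.
by congr (_ * _); apply: eq_bigr => i _; rewrite eh.
Qed.

End Scalars.

Section Scalars2.
Context (K L : fieldType) (f : {rmorphism K -> L}) (n : nat).

Lemma dif_map (p : regfun K n) X : dif (map_mpoly f p) (map_mx f X) = f (dif p X).
Proof.
rewrite /dif rmorph_sum; apply: eq_bigr => k _; rewrite rmorphM gltangent_map.
congr (_ * _); rewrite mderiv_map /meval mmap_map_mpoly mmap_rmorph.
by apply: eq_mmap => // i; rewrite /= -(glcoord_map f) map_mx1.
Qed.

Lemma ev_map (p : regfun K n) (C : fieldType) (k : {rmorphism L -> C}) g :
  ev k (map_mpoly f p) g = ev (k \o f) p g.
Proof. exact: mmap_map_mpoly. Qed.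

Lemma difD (p q : regfun K n) X : dif (p + q) X = dif p X + dif q X.
Proof.
rewrite /dif -big_split; apply: eq_bigr => k _ /=.
by rewrite mderivD mevalD mulrDl.
Qed.

Lemma difZ c (p : regfun K n) X : dif (c *: p) X = c * dif p X.
Proof.
rewrite /dif mulr_sumr; apply: eq_bigr => k _ /=.
by rewrite mderivZ mevalZ mulrA.
Qed.

Lemma evD (p q : regfun K n) g : ev f (p + q) g = ev f p g + ev f q g.
Proof. exact: raddfD. Qed.

Lemma evZ c (p : regfun K n) g : ev f (c *: p) g = f c * ev f p g.
Proof. exact: mmapZ. Qed.

Context (a b : {additive L -> K}) (i : L).
Hypothesis dec : forall x, x = f (a x) + i * f (b x).

Lemma regfun_decomp (p : regfun L n) :
  p = map_mpoly f (map_mpoly a p) + i *: map_mpoly f (map_mpoly b p).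
Proof.
by apply/mpolyP => m; rewrite mcoeffD mcoeffZ !mcoeff_map_mpoly; apply: dec.
Qed.

End Scalars2.

Lemma ev_decomp (K L : fieldType) (f : {rmorphism K -> L}) (n : nat)
    (a b : {additive L -> K}) (i : L) (dec : forall x, x = f (a x) + i * f (b x))
    (p : regfun L n) g :
  ev idfun p g = ev f (map_mpoly a p) g + i * ev f (map_mpoly b p) g.
Proof. by rewrite {1}[p](regfun_decomp dec) evD evZ !ev_map. Qed.

Lemma dif_decomp (K L : fieldType) (f : {rmorphism K -> L}) (n : nat)
    (a b : {additive L -> K}) (i : L) (dec : forall x, x = f (a x) + i * f (b x))
    (p : regfun L n) X :
  dif p X = dif (map_mpoly f (map_mpoly a p)) X + i * dif (map_mpoly f (map_mpoly b p)) X.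
Proof. by rewrite {1}[p](regfun_decomp dec) difD difZ. Qed.

Lemma dif_map_eq0 (K L : fieldType) (f : {rmorphism K -> L}) (n : nat)
    (a b : {additive L -> K}) (i : L) (dec : forall x, x = f (a x) + i * f (b x))
    (p : regfun L n) X :
  dif (map_mpoly a p) X = 0 -> dif (map_mpoly b p) X = 0 -> dif p (map_mx f X) = 0.
Proof.
by move=> a0 b0; rewrite (dif_decomp dec) !dif_map a0 b0 rmorph0 mulr0 addr0.
Qed.

Lemma gltangent_linear (K : fieldType) (n : nat) c (X Y : 'M[K]_n) k :
  gltangent (X + c *: Y) k = gltangent X k + c * gltangent Y k.
Proof.
rewrite /gltangent mxE [in RHS]mxE [X in _ + _ * X]mxE; case: split => j.
- by rewrite linearD linearZ !mxE.
- by rewrite !mxE mxtraceD mxtraceZ opprD mulrnDl -mulrN mulrnAr.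
Qed.

Lemma dif_tangentD (K : fieldType) (n : nat) (p : regfun K n) c X Y :
  dif p (X + c *: Y) = dif p X + c * dif p Y.
Proof.
rewrite /dif mulr_sumr -big_split; apply: eq_bigr => k _ /=.
by rewrite mulrCA -mulrDr gltangent_linear.
Qed.

Lemma dif_ReIm (K L : fieldType) (f : {rmorphism K -> L}) (n : nat)
    (a b : L -> K) (i : L) (dec : forall x, x = f (a x) + i * f (b x))
    (p : regfun K n) M :
  dif (map_mpoly f p) M = f (dif p (map_mx a M)) + i * f (dif p (map_mx b M)).
Proof.
rewrite -!dif_map -dif_tangentD; congr (dif _ _).
by apply/matrixP => k l; rewrite !mxE.
Qed.

(* The real and imaginary parts as additive maps on [R[i]] itself. *)
Definition ReC (R : realType) (x : R[i]) : R := complex.Re x.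
Definition ImC (R : realType) (x : R[i]) : R := complex.Im x.

Section ReImAdditive.
Context (R : realType).
Lemma ReC_is_additive : additive (@ReC R). Proof. by case=> [a b] [c d]. Qed.
Lemma ImC_is_additive : additive (@ImC R). Proof. by case=> [a b] [c d]. Qed.
HB.instance Definition _ := GRing.isAdditive.Build R[i] R (@ReC R) ReC_is_additive.
HB.instance Definition _ := GRing.isAdditive.Build R[i] R (@ImC R) ImC_is_additive.
End ReImAdditive.

Section Conjugation.
Context (R : realType) (n : nat).
Local Notation C := R[i].
Local Notation rC := (real_complex R).
Local Notation idC := (idfun : C -> C).
Local Notation cj := (@conjc R).

Lemma conj_mxK : involutive (@conj_mx R n).
Proof. by move=> g; apply/matrixP => i j; rewrite !mxE conjcK. Qed.

Lemma conj_mxM (g h : 'M[C]_n) : conj_mx (g *m h) = conj_mx g *m conj_mx h.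
Proof. exact: map_mxM. Qed.

Lemma conj_mx1 : conj_mx (1%:M : 'M[C]_n) = 1%:M.
Proof. exact: map_mx1. Qed.

Lemma ev_real (p : regfun R n) (g : 'M[C]_n) :
  ev idC (map_mpoly rC p) g = ev rC p g.
Proof. by rewrite ev_map. Qed.

Lemma ev_conj_real (p : regfun R n) (g : 'M[C]_n) :
  ev rC p (conj_mx g) = conjc (ev rC p g).
Proof.
rewrite /ev (mmap_rmorph cj); apply: eq_mmap => i /=; first exact: esym (conjc_real _).
exact: glcoord_map.
Qed.

Lemma ev_conj (p : regfun C n) (g : 'M[C]_n) :
  ev idC (map_mpoly cj p) g = conjc (ev idC p (conj_mx g)).
Proof.
rewrite ev_map /ev (mmap_rmorph cj); apply: eq_mmap => i //=.
by rewrite glcoord_map conjcK.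
Qed.

Definition rfRe (p : regfun C n) : regfun R n := map_mpoly (@ReC R) p.
Definition rfIm (p : regfun C n) : regfun R n := map_mpoly (@ImC R) p.

Lemma regfun_ReIm (p : regfun C n) :
  p = map_mpoly rC (rfRe p) + 'i%C *: map_mpoly rC (rfIm p).
Proof. exact: (regfun_decomp (f := rC) (a := @ReC R) (b := @ImC R) (@complexE R)). Qed.

Context (B : set 'M[C]_n) (algB : algebraic_group_over rC B).

Lemma grp_conj g : B g -> B (conj_mx g).
Proof.
case: algB => _ [S ->] [gu g0]; split; first by rewrite /= map_unitmx.
by move=> p Sp; rewrite ev_conj_real g0 ?conjc0.
Qed.

Lemma ev_ReIm (p : regfun C n) g :
  ev idC p g = ev rC (rfRe p) g
               + 'i%C * ev rC (rfIm p) g.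
Proof. exact: (ev_decomp (f := rC) (a := @ReC R) (b := @ImC R) (@complexE R)). Qed.

Lemma complexi_neq0 : 'i%C != 0 :> C.
Proof. by rewrite eq_complex /= oner_eq0 andbF. Qed.

Lemma conj_i : conjc 'i%C = - 'i%C :> C.
Proof. by apply/eqP; rewrite eq_complex /= oppr0 !eqxx. Qed.

Lemma conj_addi (x y : C) : conjc (x + 'i%C * y) = conjc x - 'i%C * conjc y.
Proof.
transitivity (conjc x + conjc 'i%C * conjc y); first by rewrite rmorphD rmorphM.
by rewrite conj_i mulNr.
Qed.

Lemma vanish_ReIm (p : regfun C n) : (forall g, B g -> ev idC p g = 0) ->
  forall g, B g -> ev rC (rfRe p) g = 0 /\
                   ev rC (rfIm p) g = 0.
Proof.
move=> p0 g Bg; have := p0 _ (grp_conj Bg); have := p0 _ Bg.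
rewrite !ev_ReIm !ev_conj_real; set x := ev _ _ _; set y := ev _ _ _.
move=> e1 e2; have {}e2 : x - 'i%C * y = 0.
  move: e2 => /(congr1 cj) e2; rewrite -[x]conjcK -[y]conjcK.
  by rewrite -conj_addi; apply: (etrans e2); apply: conjc0.
have x0 : x = 0.
  have /eqP : x *+ 2 = 0 by rewrite mulr2n -{1}(addrK ('i%C * y) x) e1 sub0r addrC e2.
  by rewrite mulrn_eq0 /= => /eqP.
by move: e1; rewrite x0 add0r => /eqP; rewrite mulf_eq0 (negPf complexi_neq0) => /eqP.
Qed.

Lemma lie_conj X : lie_of idC B X -> lie_of idC B (conj_mx X).
Proof.
move=> LX p p0; rewrite -[p](_ : map_mpoly cj (map_mpoly cj p) = p).
  rewrite dif_map LX ?rmorph0// => g Bg.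
  by rewrite ev_conj p0; [apply: conjc0|apply: grp_conj].
by apply/mpolyP => m; rewrite !mcoeff_map_mpoly /= conjcK.
Qed.

Lemma lie_real X : lie_of rC B X -> lie_of idC B (map_mx rC X).
Proof.
move=> LX p p0.
apply: (dif_map_eq0 (f := rC) (a := @ReC R) (b := @ImC R) (@complexE R)).
- by apply: LX => g Bg; case: (vanish_ReIm p0 Bg).
- by apply: LX => g Bg; case: (vanish_ReIm p0 Bg).
Qed.

End Conjugation.

Definition cconj (R : realType) (V : lmodType R[i]) : Type := V.

Section ConjLmod.
Context (R : realType) (V : lmodType R[i]).

HB.instance Definition _ := GRing.Zmodule.copy (cconj V) V.

Definition cconj_scale (c : R[i]) (v : cconj V) : cconj V := conjc c *: (v : V).

Lemma cconj_scaleA c d v : cconj_scale c (cconj_scale d v) = cconj_scale (c * d) v.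
Proof. by rewrite /cconj_scale scalerA rmorphM. Qed.

Lemma cconj_scale1 v : cconj_scale 1 v = v.
Proof. by rewrite /cconj_scale rmorph1 scale1r. Qed.

Lemma cconj_scaleDr : right_distributive cconj_scale +%R.
Proof. by move=> c u v; apply: scalerDr. Qed.

Lemma cconj_scaleDl v : {morph cconj_scale^~ v : c d / c + d}.
Proof. by move=> c d; rewrite /cconj_scale rmorphD scalerDl. Qed.

HB.instance Definition _ := GRing.Zmodule_isLmodule.Build R[i] (cconj V)
  cconj_scaleA cconj_scale1 cconj_scaleDr cconj_scaleDl.

Lemma cconjE c (v : cconj V) : c *: v = conjc c *: (v : V).
Proof. by []. Qed.

End ConjLmod.

Section CplxTheory.
Context (R : realType) (V : lmodType R).
Implicit Types (v : V) (w : cplx V).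

Lemma cplxE w : w = inC w.1 + 'i%C *: inC w.2.
Proof.
case: w => x y; congr (_, _) => /=.
- by rewrite scale0r scaler0 subr0 addr0.
- by rewrite scale1r scaler0 !add0r.
Qed.

Lemma inC_linear (r : R) u v : inC (r *: u + v) = r%:C *: inC u + inC v.
Proof.
congr (_, _) => /=; first by rewrite scale0r subr0.
by rewrite scale0r scaler0 !addr0.
Qed.

Lemma conjC_vecK : involutive (@conjC_vec R V).
Proof. by case=> x y; rewrite /conjC_vec /= opprK. Qed.

Lemma conjC_vec_inC v : conjC_vec (inC v) = inC v.
Proof. by rewrite /conjC_vec /= oppr0. Qed.

Lemma conjC_vec_linear c w w' : conjC_vec (c *: w + w') = conjc c *: conjC_vec w + conjC_vec w'.
Proof.
case: c w w' => [a b] [x y] [x' y']; congr (_, _) => /=.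
- by rewrite scalerN scaleNr opprK.
- by rewrite scalerN scaleNr !opprD.
Qed.

Lemma conjC_vecD w w' : conjC_vec (w + w') = conjC_vec w + conjC_vec w'.
Proof. by have := conjC_vec_linear 1 w w'; rewrite rmorph1 !scale1r. Qed.

Lemma conjC_vec0 : conjC_vec 0 = 0 :> cplx V.
Proof. exact: conjC_vec_inC. Qed.

Lemma conjC_vecZ c w : conjC_vec (c *: w) = conjc c *: conjC_vec w.
Proof. by have := conjC_vec_linear c w 0; rewrite conjC_vec0 !addr0. Qed.

Lemma conjC_vec_sum (T : Type) (s : seq T) (F : T -> cplx V) :
  conjC_vec (\sum_(i <- s) F i) = \sum_(i <- s) conjC_vec (F i).
Proof. exact: (big_morph _ conjC_vecD conjC_vec0). Qed.

End CplxTheory.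

Lemma linear_facts (K : pzRingType) (U V : lmodType K) (f : U -> V) : linear f ->
  [/\ {morph f : x y / x + y}, f 0 = 0, {morph f : x / - x} & forall c, {morph f : x / c *: x}].
Proof.
move=> lf; have fD x y : f (x + y) = f x + f y.
  by have := lf 1 x y; rewrite !scale1r.
have f0 : f 0 = 0 by apply: (addrI (f 0)); rewrite -fD !addr0.
have fZ c x : f (c *: x) = c *: f x by have := lf c x 0; rewrite f0 !addr0.
by split=> // x; rewrite -scaleN1r fZ scaleN1r.
Qed.

Section CbilinTheory.
Context (R : realType) (U V W : lmodType R) (f : U -> V -> W).
Hypotheses (fl : forall x, linear (f x)) (fr : forall y, linear (f^~ y)).

Lemma cbilin_conj z w :
  cbilin f (conjC_vec z) (conjC_vec w) = conjC_vec (cbilin f z w).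
Proof.
have fNr x y : f x (- y) = - f x y by case: (linear_facts (fl x)) => _ _ ->.
have fNl x y : f (- x) y = - f x y by case: (linear_facts (fr y)) => _ _ ->.
by rewrite /cbilin /conjC_vec /= !fNr !fNl opprK opprD.
Qed.

Lemma cbilin_inC x y : cbilin f (inC x) (inC y) = inC (f x y).
Proof.
have f0r z : f z 0 = 0 by case: (linear_facts (fl z)).
have f0l z : f 0 z = 0 by case: (linear_facts (fr z)).
by rewrite /cbilin /inC /= !f0r !f0l subr0 addr0.
Qed.

End CbilinTheory.

Section RealRep.
Context (R : realType) (n : nat) (B : set 'M[R[i]]_n).
Hypothesis algB : algebraic_group_over (real_complex R) B.
Context (V : lmodType R) (rho : 'M[R[i]]_n -> cplx V -> cplx V).
Hypothesis rat : rational_rep (real_complex R) (@inC R V) B rho.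

Lemma real_rep_conj g w : B g -> rho (conj_mx g) (conjC_vec w) = conjC_vec (rho g w).
Proof.
case: rat => lin _ _ orb Bg; have Bg' := grp_conj algB Bg.
have inj v : rho (conj_mx g) (inC v) = conjC_vec (rho g (inC v)).
  have [s os] := orb v; rewrite (os _ Bg) (os _ Bg') conjC_vec_sum.
  by apply: eq_bigr => fv _; rewrite conjC_vecZ conjC_vec_inC ev_conj_real.
have [gD _ _ gZ] := linear_facts (lin _ Bg).
have [gD' _ _ gZ'] := linear_facts (lin _ Bg').
rewrite [in LHS](cplxE w) conjC_vecD conjC_vecZ !conjC_vec_inC gD' gZ' !inj.
by rewrite -conjC_vecZ -conjC_vecD -gZ -gD -cplxE.
Qed.

End RealRep.

Section ConjModule.
Context (R : realType) (P : lie_pair R) (X : cmodule P).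
Local Notation C := R[i].
Local Notation idC := (idfun : C -> C).
Local Notation cj := (@conjc R).

Definition conj_grp (g : 'M[C]_(psize P)) (x : cconj X) : cconj X :=
  @cgrp R P X (conj_mx g) x.

Definition conj_lie (z : cplx (plie P)) (x : cconj X) : cconj X :=
  @clie R P X (conjC_vec z) x.

Let conj_s (s : seq (regfun C (psize P) * X)) : seq (regfun C (psize P) * cconj X) :=
  [seq (map_mpoly cj fv.1, fv.2 : cconj X) | fv <- s].

Let conj_orbit v s : orbit_map idC idfun (pgrp P) (@cgrp R P X) v s ->
  orbit_map idC idfun (pgrp P) conj_grp v (conj_s s).
Proof.
move=> os g Bg; rewrite /conj_grp os; last exact: (grp_conj (pgrp_alg P)).
rewrite big_map; apply: eq_bigr => fv _ /=.
by rewrite ev_conj cconjE conjcK.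
Qed.

Let conj_s' (s : seq (regfun C (psize P) * cconj X)) : seq (regfun C (psize P) * X) :=
  [seq (map_mpoly cj fv.1, fv.2 : X) | fv <- s].

Let conj_orbit' v s : orbit_map idC idfun (pgrp P) conj_grp v s ->
  orbit_map idC idfun (pgrp P) (@cgrp R P X) v (conj_s' s).
Proof.
move=> os g Bg; have := os _ (grp_conj (pgrp_alg P) Bg).
rewrite /conj_grp conj_mxK => ->.
rewrite big_map; apply: eq_bigr => fv _ /=.
by rewrite ev_conj cconjE.
Qed.

Lemma conj_grp_rational : rational_rep idC idfun (pgrp P) conj_grp.
Proof.
have [lin r1 rM orb] := @cgrp_rational R P X; split.
- move=> g Bg c u v; exact: (lin _ (grp_conj (pgrp_alg P) Bg)).
- by move=> w; rewrite /conj_grp conj_mx1 r1.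
- by move=> g h Bg Bh w; rewrite /conj_grp conj_mxM rM//; apply: (grp_conj (pgrp_alg P)).
- by move=> v; have [s /conj_orbit os] := orb v; exists (conj_s s).
Qed.

Lemma conj_lie_action : lie_action (cbilin (pbr P)) conj_lie.
Proof.
have [l1 l2 br] := @clie_action R P X.
have [b1 b2 _ _] := @pbr_lie R P.
split.
- move=> x c u v; exact: l1.
- by move=> v c x y; rewrite /conj_lie conjC_vec_linear l2.
- by move=> x y v; rewrite /conj_lie -cbilin_conj// br.
Qed.

Lemma conj_lie_equiv g : pgrp P g -> forall x v,
  conj_grp g (conj_lie x v) = conj_lie (pAd P g x) (conj_grp g v).
Proof.
move=> Bg x v; rewrite /conj_grp /conj_lie clie_equiv; last exact: (grp_conj (pgrp_alg P)).
by rewrite (real_rep_conj (pgrp_alg P) (@pAd_rational R P)).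
Qed.

Lemma cmxlin_conj (f : 'M[R]_(psize P) -> plie P) (M : 'M[C]_(psize P)) :
  cmxlin f (conj_mx M) = (f (map_mx (@complex.Re R) M), f (- map_mx (@complex.Im R) M)).
Proof.
by congr (f _, f _); apply/matrixP => i j; rewrite !mxE; case: (M i j).
Qed.

Lemma lie_ReIm (M : 'M[C]_(psize P)) : lie_of idC (pgrp P) M ->
  lie_of (real_complex R) (pgrp P) (map_mx (@complex.Re R) M) /\
  lie_of (real_complex R) (pgrp P) (map_mx (@complex.Im R) M).
Proof.
move=> LM; have key p : (forall g, pgrp P g -> ev (real_complex R) p g = 0) ->
    dif p (map_mx (@complex.Re R) M) = 0 /\ dif p (map_mx (@complex.Im R) M) = 0.
  move=> p0; have : dif (map_mpoly (real_complex R) p) M = 0.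
    by apply: LM => g Bg; rewrite ev_real p0.
  rewrite (dif_ReIm (f := real_complex R) (@complexE R)).
  by move=> /eqP; rewrite eq_complex /= !(mul0r, mul1r, mulr0, addr0, add0r, subr0) =>
    /andP[/eqP -> /eqP ->].
by split=> p /key[].
Qed.

Let conj_dif_aux (M : 'M[C]_(psize P)) : lie_of idC (pgrp P) M ->
  conjC_vec (cmxlin (pincl P) M) = cmxlin (pincl P) (conj_mx M).
Proof.
move=> /lie_ReIm[LR LI]; rewrite cmxlin_conj /conjC_vec /=; congr (_, _).
have [lin _ _] := @pincl_mono R P.
have L0 : lie_of (real_complex R) (pgrp P) 0.
  by move=> p _; have := dif_tangentD p (-1) 0 0; rewrite scaler0 addr0 mulN1r subrr.
have i0 : pincl P 0 = 0.
  by have := lin 1 0 0 L0 L0; rewrite !scale1r addr0 => /eqP; rewrite -subr_eq0 opprD addNKr oppr_eq0 => /eqP.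
by have := lin (-1) _ 0 LI L0; rewrite !addr0 i0 !scaleN1r addr0.
Qed.

Lemma conj_lie_dif : is_differential idC idfun (pgrp P) conj_grp
  (fun M => conj_lie (cmxlin (pincl P) M)).
Proof.
move=> M LM v s os; rewrite /conj_lie conj_dif_aux//.
have LM' := lie_conj (pgrp_alg P) LM.
rewrite (@clie_dif R P X _ LM' _ _ (conj_orbit' os)) big_map.
by apply: eq_bigr => fv _; rewrite dif_map.
Qed.

(* The carrier of conj_module is that of X, with scalars acting through
   conjugation, as do B' and a' (for their real structures). *)
Definition conj_module : cmodule P :=
  CModule conj_grp_rational conj_lie_action conj_lie_equiv conj_lie_dif.

End ConjModule.

Definition realify (R : realType) (V : lmodType R[i]) : Type := V.

Section RealLmod.
Context (R : realType) (V : lmodType R[i]).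

HB.instance Definition _ := GRing.Zmodule.copy (realify V) V.

Definition realify_scale (r : R) (v : realify V) : realify V := r%:C *: (v : V).

Lemma realify_scaleA r s v : realify_scale r (realify_scale s v) = realify_scale (r * s) v.
Proof. by rewrite /realify_scale scalerA rmorphM. Qed.

Lemma realify_scale1 v : realify_scale 1 v = v.
Proof. by rewrite /realify_scale rmorph1 scale1r. Qed.

Lemma realify_scaleDr : right_distributive realify_scale +%R.
Proof. by move=> c u v; apply: scalerDr. Qed.

Lemma realify_scaleDl v : {morph realify_scale^~ v : r s / r + s}.
Proof. by move=> c d; rewrite /realify_scale rmorphD scalerDl. Qed.

HB.instance Definition _ := GRing.Zmodule_isLmodule.Build R (realify V)
  realify_scaleA realify_scale1 realify_scaleDr realify_scaleDl.

Lemma realifyE r (v : realify V) : r *: v = r%:C *: (v : V).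
Proof. by []. Qed.

(* The isomorphism of C (x)_R Res V with V + conj V. *)
Definition pl (w : cplx (realify V)) : V := (w.1 : V) + 'i%C *: (w.2 : V).
Definition mi (w : cplx (realify V)) : V := (w.1 : V) - 'i%C *: (w.2 : V).
Definition back (u v : V) : cplx (realify V) :=
  ((2 : R[i])^-1 *: (u + v) : V, (- ((2 : R[i])^-1 * 'i%C)) *: (u - v) : V).

Lemma sqri : 'i%C * 'i%C = -1 :> R[i].
Proof. by rewrite -expr2 sqr_i. Qed.

Lemma half_sum (u : V) : (2 : R[i])^-1 *: (u + u) = u.
Proof.
rewrite -[u in LHS]scale1r -scalerDl scalerA mulVf ?scale1r//.
by rewrite pnatr_eq0.
Qed.

Lemma pl_back u v : pl (back u v) = u.
Proof.
rewrite /pl /back /= scalerA mulrN mulrCA sqri mulrN1 opprK -scalerDr.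
by rewrite addrACA subrr addr0 half_sum.
Qed.

Lemma mi_back u v : mi (back u v) = v.
Proof.
rewrite /mi /back /= scalerA mulrN mulrCA sqri mulrN1 opprK -scalerBr.
by rewrite opprB addrC addrA subrK half_sum.
Qed.

Lemma im_part (x y : V) :
  y = (- ((2 : R[i])^-1 * 'i%C)) *: ((x + 'i%C *: y) - (x - 'i%C *: y)).
Proof.
rewrite opprB addrC addrA subrK -scalerDr scalerA mulNr -mulrA sqri.
by rewrite mulrN1 opprK half_sum.
Qed.

Lemma plmi_inj w w' : pl w = pl w' -> mi w = mi w' -> w = w'.
Proof.
move=> e1 e2; suff K x : x = back (pl x) (mi x) by rewrite (K w) (K w') e1 e2.
case: x => x y; congr (_, _); rewrite /pl /mi /=.
- by rewrite addrACA subrr addr0 half_sum.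
- exact: im_part.
Qed.

Lemma cmul_pair (a b : R) (x y : V) :
  (a +i* b) *: (x + 'i%C *: y) =
  (a%:C *: x - b%:C *: y) + 'i%C *: (a%:C *: y + b%:C *: x).
Proof.
rewrite [_ +i* _]complexE /= scalerDl !scalerDr !scalerA.
have -> : 'i%C * b%:C * 'i%C = - b%:C by rewrite mulrAC sqri mulN1r.
rewrite (mulrC a%:C) scaleNr (addrC (('i%C * b%:C) *: x)) addrACA.
by [].
Qed.

Lemma pl_linear c w w' : pl (c *: w + w') = c *: pl w + pl w'.
Proof.
case: c w w' => [a b] [x y] [x' y'].
transitivity ((a%:C *: (x : V) - b%:C *: (y : V) + (x' : V))
  + 'i%C *: (a%:C *: (y : V) + b%:C *: (x : V) + (y' : V))); first by [].
by rewrite scalerDr addrACA -cmul_pair.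
Qed.

Lemma miE z : mi z = pl (conjC_vec z).
Proof. by rewrite /mi /pl /= scalerN. Qed.

Lemma mi_linear c w w' : mi (c *: w + w') = conjc c *: mi w + mi w'.
Proof.
by rewrite !miE conjC_vec_linear pl_linear.
Qed.

Lemma pl_inC (v : V) : pl (inC (v : realify V)) = v.
Proof. by rewrite /pl /= scaler0 addr0. Qed.

Lemma mi_inC (v : V) : mi (inC (v : realify V)) = v.
Proof. by rewrite /mi /= scaler0 subr0. Qed.

Lemma pl0 : pl 0 = 0. Proof. exact: pl_inC. Qed.
Lemma mi0 : mi 0 = 0. Proof. exact: mi_inC. Qed.

Lemma plD w w' : pl (w + w') = pl w + pl w'.
Proof. by have := pl_linear 1 w w'; rewrite !scale1r. Qed.

Lemma miD w w' : mi (w + w') = mi w + mi w'.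
Proof. by have := mi_linear 1 w w'; rewrite rmorph1 !scale1r. Qed.

Lemma plZ c w : pl (c *: w) = c *: pl w.
Proof. by have := pl_linear c w 0; rewrite pl0 !addr0. Qed.

Lemma miZ c w : mi (c *: w) = conjc c *: mi w.
Proof. by have := mi_linear c w 0; rewrite mi0 !addr0. Qed.

Lemma pl_sum (T : Type) (s : seq T) F : pl (\sum_(i <- s) F i) = \sum_(i <- s) pl (F i).
Proof. exact: (big_morph _ plD pl0). Qed.

Lemma mi_sum (T : Type) (s : seq T) F : mi (\sum_(i <- s) F i) = \sum_(i <- s) mi (F i).
Proof. exact: (big_morph _ miD mi0). Qed.

End RealLmod.

Section Restriction.
Context (R : realType) (P : lie_pair R) (X : cmodule P).
Local Notation C := R[i].
Local Notation idC := (idfun : C -> C).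
Local Notation rC := (real_complex R).
Local Notation G := (@cgrp R P X).
Local Notation Lx := (@clie R P X).

(* On C (x)_R X, which is X + conj X via [pl] and [mi], g acts by g on X and,
   after conjugation, by conj g on conj X; this is the action of the coaction
   X -> X (x)_C C[B'] = X (x)_R R[B]. *)
Definition res_grp (g : 'M[C]_(psize P)) (w : cplx (realify X)) : cplx (realify X) :=
  back (G g (pl w)) (G (conj_mx g) (mi w)).

Definition res_lie (z : plie P) (x : realify X) : realify X := Lx (inC z) x.

Let cB := fun g => grp_conj (pgrp_alg P) (g := g).

Lemma res_grp_rational : rational_rep rC (@inC R (realify X)) (pgrp P) res_grp.
Proof.
have [lin r1 rM orb] := @cgrp_rational R P X; split.
- move=> g Bg c u v; apply: plmi_inj.
    by rewrite pl_linear !pl_back pl_linear lin.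
  by rewrite mi_linear !mi_back mi_linear lin//; apply: cB.
- move=> w; apply: plmi_inj; first by rewrite pl_back r1.
  by rewrite mi_back conj_mx1 r1.
- move=> g h Bg Bh w; apply: plmi_inj; first by rewrite !pl_back rM.
  by rewrite !mi_back conj_mxM rM//; apply: cB.
- move=> v; have [s os] := orb v.
  exists ([seq (rfRe fv.1, fv.2 : realify X) | fv <- s]
       ++ [seq (rfIm fv.1, 'i%C *: fv.2 : realify X) | fv <- s]).
  move=> g Bg; apply: plmi_inj.
  + rewrite pl_back (pl_inC (v : X)) os// pl_sum big_cat !big_map.
    apply: (etrans _ (big_split _ _ _ _ _)); apply: eq_bigr => fv _ /=; rewrite !plZ (pl_inC (fv.2 : X)) (pl_inC ('i%C *: fv.2 : X)).
    by rewrite ev_ReIm scalerDl scalerA (mulrC 'i%C).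
  + rewrite mi_back (mi_inC (v : X)) os; last exact: cB.
    rewrite mi_sum big_cat !big_map.
    apply: (etrans _ (big_split _ _ _ _ _)); apply: eq_bigr => fv _ /=; rewrite !miZ (mi_inC (fv.2 : X)) (mi_inC ('i%C *: fv.2 : X)).
    by rewrite ev_ReIm scalerDl scalerA (mulrC 'i%C) !ev_conj_real.
Qed.

Lemma res_lie_action : lie_action (pbr P) res_lie.
Proof.
have [l1 l2 br] := @clie_action R P X.
have [b1 b2 _ _] := @pbr_lie R P.
split.
- move=> x c u v; exact: l1.
- by move=> v c x y; rewrite /res_lie inC_linear l2.
- by move=> x y v; rewrite /res_lie -cbilin_inC// br.
Qed.

Lemma res_pl z w : pl (cbilin res_lie z w) = Lx z (pl w).
Proof.
have [l1 l2 br] := @clie_action R P X.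
have D1 u v : Lx (u + v) =1 fun x => Lx u x + Lx v x.
  by move=> x; case: (linear_facts (l2 x)) => ->.
have Z1 c u : Lx (c *: u) =1 fun x => c *: Lx u x.
  by move=> x; case: (linear_facts (l2 x)) => _ _ _ ->.
have D2 u : {morph Lx u : x y / x + y} by case: (linear_facts (l1 u)).
have Z2 u c : {morph Lx u : x / c *: x} by case: (linear_facts (l1 u)).
case: z w => [z1 z2] [x y].
transitivity ((Lx (inC z1) x - Lx (inC z2) y) + 'i%C *: (Lx (inC z1) y + Lx (inC z2) x)).
  by [].
rewrite [in RHS](cplxE (z1, z2)) D1 Z1 /pl /= !D2 !Z2 !scalerDr scalerA sqri scaleN1r.
by rewrite (addrC ('i%C *: Lx (inC z2) x)) addrACA.
Qed.

Lemma res_mi z w : mi (cbilin res_lie z w) = Lx (conjC_vec z) (mi w).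
Proof.
have [l1 l2 _] := res_lie_action.
by rewrite !miE -cbilin_conj// res_pl.
Qed.

Lemma res_lie_equiv g : pgrp P g -> forall z w,
  res_grp g (cbilin res_lie z w) = cbilin res_lie (pAd P g z) (res_grp g w).
Proof.
move=> Bg z w; apply: plmi_inj.
  by rewrite res_pl !pl_back res_pl clie_equiv.
rewrite res_mi !mi_back res_mi clie_equiv; last exact: cB.
by rewrite (real_rep_conj (pgrp_alg P) (@pAd_rational R P)).
Qed.

Lemma res_lie_dif : is_differential rC (@inC R (realify X)) (pgrp P) res_grp
  (fun M => res_lie (pincl P M)).
Proof.
move=> M LM v s os.
pose s' : seq (regfun C (psize P) * X) := [seq (map_mpoly rC fv.1, fv.2 : X) | fv <- s].
have os' : orbit_map idC idfun (pgrp P) G v s'.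
  move=> g Bg; have := congr1 (@pl R X) (os g Bg).
  rewrite pl_back (pl_inC (v : X)) pl_sum => ->.
  rewrite big_map; apply: eq_bigr => fv _ /=.
  by rewrite plZ (pl_inC (fv.2 : X)) ev_real.
have := @clie_dif R P X _ (lie_real (pgrp_alg P) LM) _ _ os'.
rewrite big_map => e; rewrite /res_lie.
have -> : inC (pincl P M) = cmxlin (pincl P) (map_mx rC M).
  have [lin _ _] := @pincl_mono R P.
  have L0 : lie_of rC (pgrp P) 0.
    by move=> p _; have := dif_tangentD p (-1) 0 0; rewrite scaler0 addr0 mulN1r subrr.
  have i0 : pincl P 0 = 0.
    by have := lin 1 0 0 L0 L0; rewrite !scale1r addr0 => /eqP; rewrite -subr_eq0 opprD addNKr oppr_eq0 => /eqP.
  rewrite /cmxlin /inC -i0; congr (pincl P _, pincl P _); apply/matrixP => i j; rewrite !mxE //.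
rewrite e; apply: eq_bigr => fv _ /=; rewrite dif_map.
by [].
Qed.

Definition res_module : rmodule P :=
  RModule res_grp_rational res_lie_action res_lie_equiv res_lie_dif.

End Restriction.

Section Forms.
Context (R : realType) (P : lie_pair R) (X : cmodule P).

Definition is_hermitian_form (h : X -> X -> R[i]) : Prop :=
  @invariant_pairing R P X (conj_module X) h /\ forall x y, h y x = conjc (h x y).

Definition positive_definite (h : X -> X -> R[i]) : Prop :=
  forall x, x != 0 -> 0 < h x x.

Definition infinitesimally_unitary : Prop :=
  exists h, is_hermitian_form h /\ positive_definite h.

Definition invariant_bilinear_form (b : X -> X -> R[i]) : Prop :=
  invariant_pairing b.

Definition nonzero_form (b : X -> X -> R[i]) : Prop := exists x y, b x y != 0.

Definition is_symmetric_form (b : X -> X -> R[i]) : Prop := forall x y, b y x = b x y.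

Definition is_antisymmetric_form (b : X -> X -> R[i]) : Prop := forall x y, b y x = - b x y.

End Forms.

Section Endomorphisms.
Context (R : realType) (P : lie_pair R) (Y : rmodule P).

Definition endomorphisms : set (Y -> Y) :=
  [set T | [/\ linear T, forall z y, T (rlie z y) = rlie z (T y) &
               forall g, pgrp P g -> forall w, clin T (rgrp g w) = rgrp g (clin T w)]].

(* The R-algebra of endomorphisms of Y is isomorphic to A. *)
Definition End_isomorphic (A : lalgType R) : Prop :=
  exists phi : A -> Y -> Y,
    [/\ forall c a a' y, phi (c *: a + a') y = c *: phi a y + phi a' y,
        forall y, phi 1 y = y,
        forall a a' y, phi (a * a') y = phi a (phi a' y),
        injective phi &
        range phi = endomorphisms].

(* The R-algebra of endomorphisms of Y has a basis 1, i, j, ij with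
   i^2 = a, j^2 = b, ji = - ij for some non-zero a, b in R, and each of its
   non-zero elements is invertible in it. *)
Definition End_quaternion_division : Prop :=
  (exists (a b : R) (i j : Y -> Y),
    [/\ a != 0 /\ b != 0,
        endomorphisms i /\ endomorphisms j,
        [/\ forall y, i (i y) = a *: y, forall y, j (j y) = b *: y &
            forall y, j (i y) = - i (j y)],
        forall T, endomorphisms T -> exists c0 c1 c2 c3 : R, forall y,
          T y = c0 *: y + c1 *: i y + c2 *: j y + c3 *: i (j y) &
        forall c0 c1 c2 c3 : R,
          (forall y, c0 *: y + c1 *: i y + c2 *: j y + c3 *: i (j y) = 0) ->
          [/\ c0 = 0, c1 = 0, c2 = 0 & c3 = 0]]) /\
  (forall T, endomorphisms T -> (exists y, T y != 0) ->
     exists T', [/\ endomorphisms T', forall y, T (T' y) = y & forall y, T' (T y) = y]).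

End Endomorphisms.

Section FrobeniusSchur.
Context (R : realType) (P : lie_pair R) (X : cmodule P).

Definition is_real : Prop := End_isomorphic (res_module X) 'M[R]_2.

(* [Rcomplex R] is [R[i]] with its structure of R-algebra. *)
Definition is_complex : Prop := End_isomorphic (res_module X) (Rcomplex R).

Definition is_quaternionic : Prop := End_quaternion_division (res_module X).

(* [FS_R e] means FS_R(X) = e. *)
Definition FS_R (e : int) : Prop :=
  [\/ e = 1 /\ is_real, e = 0 /\ is_complex | e = -1 /\ is_quaternionic].

Lemma real_not_complex : is_real -> ~ is_complex.
Proof.
case=> phi [_ _ phiM phiI phiR] [psi [_ _ psiM _ psiR]].
have comm a b : phi (a * b) = phi (b * a).
  have : range psi (phi a) by rewrite psiR -phiR; exists a.
  have : range psi (phi b) by rewrite psiR -phiR; exists b.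
  move=> [d _ ed] [c _ ec]; apply/funext => y.
  by rewrite !phiM -ec -ed -!psiM mulrC.
have /phiI/matrixP/(_ 0 0) := comm (delta_mx 0 1) (delta_mx 1 0).
rewrite -!mulmxE !mul_delta_mx !mxE /= => /eqP.
by rewrite oner_eq0.
Qed.

Lemma real_not_quaternionic : is_real -> ~ is_quaternionic.
Proof.
case=> phi [phiL _ phiM phiI phiR] [_ inv].
pose d : 'M[R]_2 := delta_mx 0 1.
have phi0 y : phi 0 y = 0.
  by have := phiL (-1) 0 0 y; rewrite !scaleN1r addrC subrr => ->; rewrite addrC subrr.
have d0 : d != 0 by apply/eqP => /matrixP/(_ 0 1)/eqP; rewrite !mxE /= oner_eq0.
have Ed : endomorphisms (phi d) by rewrite -phiR; exists d.
have [|T' [[/linear_facts[_ T'0 _ _] _ _] _ T'K]] := inv _ Ed.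
  apply: contrapT => no; move/eqP: d0; apply; apply: phiI; apply/funext => y.
  by rewrite phi0; apply: contrapT => /eqP ny; apply: no; exists y.
have dd y : phi d (phi d y) = 0.
  by rewrite -phiM /d -mulmxE mul_delta_mx_0.
move/eqP: d0; apply; apply: phiI; apply/funext => y.
by rewrite phi0 -(T'K (phi d y)) dd T'0.
Qed.

Lemma complex_not_quaternionic : is_complex -> ~ is_quaternionic.
Proof.
case=> psi [_ _ psiM _ psiR] [[a [b [i [j [_ [Ei Ej] [_ _ ij] _ ind]]]]] _].
have comm : forall y, j (i y) = i (j y).
  move: Ei Ej; rewrite -psiR => -[c _ <-] [d _ <-] y.
  by rewrite -!psiM mulrC.
have [|_ _ _ /eqP] := ind 0 0 0 1; last by rewrite oner_eq0.
move=> y; rewrite !scale0r !add0r scale1r.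
have /eqP : i (j y) + i (j y) = 0 by rewrite -{1}comm ij addNr.
rewrite -[i (j y)]scale1r -scalerDl scaler_eq0 => /orP[|/eqP -> //].
- by rewrite -mulr2n pnatr_eq0.
- exact: scaler0.
Qed.

Lemma FS_R_unique e e' : FS_R e -> FS_R e' -> e = e'.
Proof.
have rc := real_not_complex; have rq := real_not_quaternionic.
have cq := complex_not_quaternionic.
by case=> -[-> h] [] -[-> h'] //; exfalso; intuition.
Qed.

End FrobeniusSchur.

(* Main.v *)
Require Import Defs.
From mathcomp Require Import all_boot all_order all_algebra.
From mathcomp Require Import ring lra complex boolp classical_sets reals.

Set Implicit Arguments.
Unset Strict Implicit.
Unset Printing Implicit Defensive.

Import Order.TTheory GRing.Theory Num.Theory.
Local Open Scope classical_set_scope.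
Local Open Scope ring_scope.
Local Open Scope complex_scope.

(** Let h be the positive definite form, linear in the first variable.  An
    endomorphism T of X over R is the sum of its C-linear and its antilinear
    part, and both are equivariant: the first is an endomorphism of X over C,
    the second a homomorphism from X to its conjugate.

    Schur's lemma ([schur]) makes the first part a scalar.  By admissibility the
    B-homomorphisms from a finite-dimensional B-stable subspace of X to X form a
    finite-dimensional space, on which an endomorphism of X acts; it therefore
    has an eigenvalue.

    If J is a non-zero homomorphism from X to its conjugate, then J o J is a
    scalar, and a non-zero real one since it commutes with the antilinear J
    ([conj_hom_square]); every other such homomorphism is c J
    ([conj_hom_unique]).  So the endomorphisms over R are the c + d J, and
    rescaling J gives J o J = 1 or J o J = -1: a matrix algebra or the Hamilton
    quaternions ([real_of_involution], [quaternionic_of_antiinvolution]).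
    Without such a J they are the complex scalars
    ([complex_of_no_conj_hom]).

    Invariant bilinear forms correspond to the homomorphisms J through
    b x y = h x (J y) ([hom_of_form], [form_of_hom]).  The substance is that
    b(-, y) is represented by a vector although X need not be complete
    ([form_representable]): y lies in a finite-dimensional stable F, admissibility
    bounds the images in X of the conjugate of F, and b(-, F) vanishes
    on the orthogonal complement of these images.

    Finally (x, y) |-> b y x is invariant as well, so b y x = c b x y with
    c = 1 or c = -1, and h (J y) (J y) = b (J y) y = c r h y y with J o J = r;
    so c is the sign of r ([form_sign]). *)

(** * Inner products and orthonormal families *)

Section Conjugate.
Context (R : realType).
Implicit Types x y : R[i].

Lemma conjM x y : conjc (x * y) = conjc x * conjc y. Proof. exact: rmorphM. Qed.
Lemma conjD x y : conjc (x + y) = conjc x + conjc y. Proof. exact: rmorphD. Qed.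
Lemma conjN x : conjc (- x) = - conjc x. Proof. exact: rmorphN. Qed.
Lemma conj0 : conjc 0 = 0 :> R[i]. Proof. exact: rmorph0. Qed.
Lemma conj1 : conjc 1 = 1 :> R[i]. Proof. exact: rmorph1. Qed.
Lemma conjK x : conjc (conjc x) = x. Proof. exact: conjcK. Qed.

Lemma conj_ge0 x : 0 <= x -> conjc x = x.
Proof. by move=> x0; apply/CrealP; apply: ger0_real. Qed.

End Conjugate.

Section InnerProduct.
Context (R : realType) (V : lmodType R[i]).
Implicit Types (U : set V) (h : V -> V -> R[i]).

Definition inner_product h : Prop :=
  [/\ forall y (c : R[i]) x x', h (c *: x + x') y = c * h x y + h x' y,
      forall x y, h y x = conjc (h x y) &
      forall x, x != 0 -> 0 < h x x].

Definition subspace U : Prop :=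
  U 0 /\ forall (c : R[i]) x y, U x -> U y -> U (c *: x + y).

Definition comb m (u : 'I_m -> V) (a : 'rV[R[i]]_m) : V := \sum_i a 0 i *: u i.

Lemma comb_linear m (u : 'I_m -> V) : linear (comb u).
Proof.
move=> c a b; rewrite /comb scaler_sumr -big_split; apply: eq_bigr => i _ /=.
by rewrite !mxE scalerDl scalerA.
Qed.

Lemma subspace_comb U m (u : 'I_m -> V) a :
  subspace U -> (forall i, U (u i)) -> U (comb u a).
Proof.
case=> U0 UD Uu; rewrite /comb; elim/big_rec: _ => // i x _ Ux.
exact: UD.
Qed.

Context (h : V -> V -> R[i]) (hP : inner_product h).

Definition coords m (u : 'I_m -> V) (x : V) : 'rV[R[i]]_m := \row_i h x (u i).

Definition orthonormal m (u : 'I_m -> V) : Prop :=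
  forall i j, h (u i) (u j) = (i == j)%:R.

Lemma inner_linearl y : linear (h^~ y : V -> R[i]^o).
Proof. by case: hP => hl _ _ c x x'; apply: hl. Qed.

Lemma inner_antir x (c : R[i]) y y' : h x (c *: y + y') = conjc c * h x y + h x y'.
Proof.
case: hP => hl hc _; rewrite hc hl conjD conjM.
by rewrite (hc y x) (hc y' x).
Qed.

Lemma inner_0r x : h x 0 = 0.
Proof.
case: hP => _ hc _; have [_ e _ _] := linear_facts (inner_linearl x).
by rewrite hc e conj0.
Qed.

Lemma inner_Zr x (c : R[i]) y : h x (c *: y) = conjc c * h x y.
Proof. by have := inner_antir x c y 0; rewrite inner_0r !addr0. Qed.

Lemma inner_eq x y : (forall z, h z x = h z y) -> x = y.
Proof.
move=> e; apply/eqP; rewrite -subr_eq0; apply/negPn/negP.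
case: hP => _ _ hp /hp; have := inner_antir (x - y) (-1) y x.
rewrite scaleN1r addrC => ->; rewrite e conjN conj1 mulN1r addNr.
by rewrite ltxx.
Qed.

Lemma coords_linear m (u : 'I_m -> V) : linear (coords u).
Proof. by case: hP => hl _ _ c x y; apply/rowP => i; rewrite !mxE hl. Qed.

Lemma innerZsum (I : Type) (r : seq I) (c : I -> R[i]) (v : I -> V) y :
  h (\sum_(i <- r) c i *: v i) y = \sum_(i <- r) c i * h (v i) y.
Proof.
have [hD h0 _ hZ] := linear_facts (inner_linearl y).
rewrite (big_morph (h^~ y) hD h0); apply: eq_bigr => i _; exact: hZ.
Qed.

Lemma inner_comb_eq0 m (u : 'I_m -> V) x a : coords u x = 0 -> h x (comb u a) = 0.
Proof.
case: hP => _ hc _ /rowP xu; rewrite hc innerZsum big1 ?conj0// => i _.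
by rewrite hc; have := xu i; rewrite !mxE => ->; rewrite conj0 mulr0.
Qed.

Section Family.
Context m (u : 'I_m -> V) (ou : orthonormal u).

Lemma combK a : coords u (comb u a) = a.
Proof.
apply/rowP => j; rewrite mxE innerZsum (bigD1 j)//= ou eqxx mulr1.
by rewrite big1 ?addr0// => i /negPf ij; rewrite ou ij mulr0.
Qed.

Lemma coords_residue x : coords u (x - comb u (coords u x)) = 0.
Proof.
have [cD _ cN _] := linear_facts (coords_linear u).
by rewrite cD cN combK subrr.
Qed.

(** One Gram-Schmidt step.  The new family stays in every subspace that
    contains the old one and x. *)
Lemma orthonormal_extend x : x != comb u (coords u x) ->
  exists u' : 'I_m.+1 -> V, orthonormal u' /\
    forall U, subspace U -> U x -> (forall i, U (u i)) -> forall i, U (u' i).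
Proof.
rewrite -subr_eq0; set y := x - _ => y0.
have [hl hc hp] := hP; have hy := hp y y0.
have yu j : h y (u j) = 0.
  by have /rowP/(_ j) := coords_residue x; rewrite !mxE.
pose s := sqrtC (h y y).
have s0 : 0 < s by rewrite sqrtC_gt0.
have cs : conjc s^-1 = s^-1.
  by apply: conj_ge0; rewrite invr_ge0 ltW.
pose w := s^-1 *: y.
have hwl z : h w z = s^-1 * h y z.
  by have [_ _ _ hZ] := linear_facts (inner_linearl z); apply: hZ.
have wu j : h w (u j) = 0 by rewrite hwl yu mulr0.
have ww : h w w = 1.
  rewrite hwl hc hwl (_ : conjc _ = s^-1 * h y y).
    by rewrite mulrA -expr2 exprVn sqrtCK mulVf// gt_eqF.
  by rewrite conjM cs -hc.
exists (fun i => if unlift ord0 i is Some j then u j else w); split.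
- move=> i j; case: (unliftP ord0 i) => [i' ->|->]; case: (unliftP ord0 j) => [j' ->|->].
  + by rewrite ou (inj_eq lift_inj).
  + by rewrite hc wu conj0.
  + by rewrite wu.
  + by rewrite ww.
- move=> U sU Ux Uu i; case: (unlift ord0 i) => [j|] //.
  have [U0 UD] := sU.
  have Uy : U y.
    by rewrite /y addrC -scaleN1r; apply: UD => //; apply: subspace_comb.
  by have := UD s^-1 _ _ Uy U0; rewrite addr0.
Qed.

(** A linear relation among the rows of coefficients of the u_i would be one
    among the u_i, and [combK] excludes these. *)
Lemma orthonormal_bound n (f : 'rV[R[i]]_n -> V) : linear f ->
  (forall i, exists a, u i = f a) -> (m <= n)%N.
Proof.
move=> /linear_facts[fD f0 _ fZ] /choice[a ua].
pose M := \matrix_i a i.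
have combM r : comb u r = f (r *m M).
  rewrite mulmx_sum_row (big_morph f fD f0); apply: eq_bigr => i _.
  by rewrite fZ rowK ua.
suff /eqP <- : row_free M by apply: rank_leq_col.
rewrite -kermx_eq0; apply/eqP/row_matrixP => i; rewrite row0.
rewrite -[LHS]combK combM -row_mul mulmx_ker row0 f0.
by have [_ c0 _ _] := linear_facts (coords_linear u).
Qed.

End Family.

(** Extend an orthonormal family in U one vector at a time; [orthonormal_bound]
    stops the process.  The linear map f, whose range contains U, says that U is
    finite-dimensional without asking for a [vectType] structure. *)
Lemma orthonormal_basis U n (f : 'rV[R[i]]_n -> V) : subspace U -> linear f ->
  (forall x, U x -> exists a, x = f a) ->
  exists m (u : 'I_m -> V), [/\ orthonormal u, forall i, U (u i) &
    forall x, U x -> x = comb u (coords u x)].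
Proof.
move=> sU lf Uf; apply: contrapT => no.
suff [u [ou Uu]] : exists u : 'I_n.+1 -> V, orthonormal u /\ forall i, U (u i).
  by have := orthonormal_bound ou lf (fun i => Uf _ (Uu i)); rewrite ltnn.
elim: n.+1 => [|m [u [ou Uu]]]; first by exists (fun=> 0); split=> -[].
have [x [Ux xu]] : exists x, U x /\ x != comb u (coords u x).
  apply: contrapT => nx; apply: no; exists m, u; split=> // x Ux.
  by apply/eqP/negPn/negP => xu; apply: nx; exists x.
by have [u' [ou' Uu']] := orthonormal_extend ou xu; exists u'; split=> //; apply: Uu'.
Qed.

End InnerProduct.

(** * Finite-dimensional stable subspaces *)

Section FiniteSubmodules.
Context (R : realType) (P : lie_pair R) (X : cmodule P).
Local Notation idC := (idfun : R[i] -> R[i]).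

Definition stable_family h m (u : 'I_m -> X) : Prop :=
  orthonormal h u /\ forall g c, pgrp P g ->
    cgrp g (comb u c) = comb u (coords h u (cgrp g (comb u c))).

Context (h : X -> X -> R[i]) (hP : inner_product h).

(** Local finiteness.  The span of the orbit of x is stable, and a presentation
    of the orbit map of x puts it in a finite-dimensional space.  This span is
    the intersection of the subspaces that contain the orbit. *)
Lemma stable_family_through x :
  exists m (u : 'I_m -> X), stable_family h u /\ x = comb u (coords h u x).
Proof.
have [lin r1 rM orb] := @cgrp_rational R P X.
have [B1 Bm] : pgrp P 1%:M /\ forall g k, pgrp P g -> pgrp P k -> pgrp P (g *m k).
  by have [[]] := pgrp_alg P.
pose U : set X := [set y | forall S : set X, subspace S ->
  (forall g, pgrp P g -> S (cgrp g x)) -> S y].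
have Ux : U x by move=> S _ /(_ _ B1); rewrite r1.
have sU : subspace U.
  split=> [S [] //|c y z Uy Uz S sS Sx]; have [_ SD] := sS.
  by apply: SD; [apply: Uy|apply: Uz].
have gU g y : pgrp P g -> U y -> U (cgrp g y).
  move=> Bg Uy S [S0 SD] Sx; have [gD g0 _ gZ] := linear_facts (lin _ Bg).
  apply: (Uy [set y | S (cgrp g y)]); last first.
    by move=> k Bk /=; rewrite -rM//; apply/Sx/Bm.
  by split=> /= [|c y1 y2 S1 S2]; rewrite ?g0// gD gZ; apply: SD.
have [s os] := orb x.
pose v i : X := (tnth (in_tuple s) i).2.
have Uv y : U y -> exists a, y = comb v a.
  have lv := @comb_linear _ _ _ v; have [_ v0 _ _] := linear_facts lv.
  move=> /(_ [set y | exists a, y = comb v a]); apply.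
    split=> [|c y1 y2 [a ->] [b ->]]; first by exists 0; rewrite v0.
    by exists (c *: a + b); rewrite lv.
  move=> g /os ->; exists (\row_i ev idC (tnth (in_tuple s) i).1 g).
  by rewrite big_tnth /comb; apply: eq_bigr => i _; rewrite mxE.
have [m [u [ou Uu uU]]] := orthonormal_basis hP sU (@comb_linear _ _ _ v) Uv.
exists m, u; split; last exact: uU.
by split=> // g c Bg; apply: uU; apply: gU => //; apply: subspace_comb.
Qed.

(** The action of B on the span of a stable family, transported to row vectors so
    that it lives on a [vectType], as the definition of admissibility requires. *)
Definition subrep m (u : 'I_m -> X) (g : 'M[R[i]]_(psize P)) (c : 'rV[R[i]]_m) : 'rV[R[i]]_m :=
  coords h u (cgrp g (comb u c)).

Section SubRep.
Context m (u : 'I_m -> X) (su : stable_family h u).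

(** Coordinates are linear on all of X, so applying them to a presentation of an
    orbit map in X gives one in the space of row vectors. *)
Lemma subrep_rational : rational_rep idC idfun (pgrp P) (subrep u).
Proof.
have [ou stu] := su; have [lin r1 rM orb] := @cgrp_rational R P X.
have lc := coords_linear hP u; have [cD c0 _ cZ] := linear_facts lc.
split.
- by move=> g Bg c a b; rewrite /subrep comb_linear (lin _ Bg) lc.
- by move=> a; rewrite /subrep r1 combK.
- by move=> g k Bg Bk a; rewrite /subrep rM// [in LHS]stu.
- move=> a; have [s os] := orb (comb u a).
  exists [seq (fv.1, coords h u fv.2) | fv <- s] => g Bg.
  rewrite /subrep /= os// big_map (big_morph _ cD c0).
  by apply: eq_bigr => fv _; rewrite cZ.
Qed.

Lemma comb_Bhom : Bhom (subrep u) (comb u).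
Proof.
split; first exact: comb_linear.
by move=> g Bg c; have [_ stu] := su; rewrite [RHS]stu.
Qed.

End SubRep.

End FiniteSubmodules.

(** * Homomorphisms and Schur's lemma *)

Section Morphisms.
Context (R : realType) (P : lie_pair R).
Implicit Types X Y : cmodule P.

Definition module_hom X Y (f : X -> Y) : Prop :=
  [/\ linear f, forall g, pgrp P g -> forall x, f (cgrp g x) = cgrp g (f x) &
      forall z x, f (clie z x) = clie z (f x)].

Lemma module_hom_id X : module_hom (idfun : X -> X).
Proof. by split. Qed.

Lemma module_hom0 X Y : module_hom ((fun=> 0) : X -> Y).
Proof.
have [lin _ _ _] := @cgrp_rational R P Y; have [zlin _ _] := @clie_action R P Y.
split=> [c _ _|g Bg _|z _]; first by rewrite scaler0 addr0.
- by case: (linear_facts (lin _ Bg)).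
- by case: (linear_facts (zlin z)).
Qed.

Lemma module_hom_lin X Y (f k : X -> Y) c :
  module_hom f -> module_hom k -> module_hom (fun x => c *: f x + k x).
Proof.
have [lin _ _ _] := @cgrp_rational R P Y; have [zlin _ _] := @clie_action R P Y.
case=> fl fg fz [kl kg kz]; split=> [d x y|g Bg x|z x] /=.
- rewrite fl kl !scalerDr addrACA; congr (_ + _ + _).
  by rewrite !scalerA mulrC.
- by rewrite fg// kg// lin.
- by rewrite fz kz zlin.
Qed.

Lemma module_hom_scale X Y (f : X -> Y) c :
  module_hom f -> module_hom (fun x => c *: f x).
Proof.
move=> hf; have := module_hom_lin c hf (module_hom0 X Y).
by under eq_fun do rewrite addr0.
Qed.

(** The kernel is a submodule of an irreducible module. *)
Lemma module_hom_ker X Y (f : X -> Y) x : irreducible X -> module_hom f ->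
  f x = 0 -> x != 0 -> forall y, f y = 0.
Proof.
move=> [_ irr] [fl fg fz] fx x0.
have [fD f0 _ fZ] := linear_facts fl.
have [lin _ _ _] := @cgrp_rational R P Y; have [zlin _ _] := @clie_action R P Y.
have sK : submodule [set x | f x = 0].
  split=> /= [//|c y z fy fw|g y Bg fy|z y fy].
  - by rewrite fl fy fw scaler0 addr0.
  - by rewrite fg// fy; case: (linear_facts (lin _ Bg)).
  - by rewrite fz fy; case: (linear_facts (zlin z)).
case: (irr _ sK) => /seteqP[K1 K2] y.
- by have /= := K1 _ fx => x00; rewrite x00 eqxx in x0.
- by have /= := K2 y; apply.
Qed.

Lemma Bhom_comp X Y (V : lmodType R[i]) sigma (e : V -> X) (f : X -> Y) :
  module_hom f -> Bhom sigma e -> Bhom sigma (f \o e).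
Proof.
case=> fl fg _ [el eg]; split=> [c x y|g Bg x] /=; first by rewrite el fl.
by rewrite eg// fg.
Qed.

(** The maps e_j span the B-homomorphisms from a finite-dimensional stable
    subspace to X; they may be linearly dependent, so the matrix M of f on them
    is a choice.  By Cayley-Hamilton the product of the f - z, for z over the
    roots of the characteristic polynomial of M, kills x0; hence some f - z is
    not injective, and by irreducibility it vanishes. *)
Lemma schur X h (hP : inner_product (h : X -> X -> R[i])) (f : X -> X) :
  irreducible X -> admissible X -> module_hom f -> exists c, forall x, f x = c *: x.
Proof.
move=> irr adm hf; have [[x0 nx0] _] := irr.
have [m [u [su xu]]] := stable_family_through hP x0.
have [[|k] [e [eB eG]]] := adm _ _ (subrep_rational hP su).
  have [a ea] := eG _ (comb_Bhom su).
  by move: nx0; rewrite xu ea big_ord0 eqxx.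
pose E (a : 'rV[R[i]]_k.+1) c := \sum_j a 0 j *: e j c.
have EG phi : Bhom (subrep h u) phi -> exists a, forall c, phi c = E a c.
  by move=> /eG[a ea]; exists (\row_j a j) => c; rewrite ea; apply: eq_bigr => j _; rewrite mxE.
have [a0 Ea0] := EG _ (comb_Bhom su).
have [M ME] : exists M : 'M_k.+1, forall j c, f (e j c) = E (row j M) c.
  have /choice[a fa] j := EG _ (Bhom_comp hf (eB j)).
  by exists (\matrix_j a j) => j c; rewrite rowK -fa.
have El c : linear (E^~ c).
  move=> z a b; rewrite /E scaler_sumr -big_split; apply: eq_bigr => i _ /=.
  by rewrite !mxE scalerDl scalerA.
have [fl _ _] := hf; have [fD f0 _ fZ] := linear_facts fl.
have fE a c : f (E a c) = E (a *m M) c.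
  rewrite {1}/E (big_morph f fD f0); under eq_bigr do rewrite fZ ME scaler_sumr.
  rewrite exchange_big; apply: eq_bigr => j _ /=.
  by rewrite mxE scaler_suml; apply: eq_bigr => i _; rewrite mxE scalerA.
(* [y p] is the value of the polynomial p in f at x0. *)
pose y p : X := E (a0 *m horner_mx M p) (coords h u x0).
have y1 : y 1 = x0 by rewrite /y rmorph1 mulmx1 -Ea0 -xu.
have yM p z : y (p * ('X - z%:P)) = f (y p) - z *: y p.
  have [ED _ EN EZ] := linear_facts (El (coords h u x0)).
  rewrite /y fE -EZ -EN -ED rmorphM rmorphB /= horner_mx_X horner_mx_C.
  by rewrite -mulmxE mulmxBr !mulmxBr !mulmxA mul_mx_scalar.
have step r p : y p != 0 -> y (p * \prod_(z <- r) ('X - z%:P)) = 0 ->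
    exists c, forall x, f x = c *: x.
  elim: r p => [|z r ih] p yp; first by rewrite big_nil mulr1 => /eqP; rewrite (negPf yp).
  rewrite big_cons mulrA => pr0.
  have [fz|/ih] := eqVneq (y (p * ('X - z%:P))) 0; last by apply.
  exists z => x; apply/eqP; rewrite -subr_eq0 addrC -scaleNr; apply/eqP.
  have hz := module_hom_lin (- z) (module_hom_id X) hf.
  by apply: (module_hom_ker irr hz _ yp); rewrite scaleNr addrC -yM.
have [r Er] := closed_field_poly_normal (char_poly M).
apply: (step r 1); first by rewrite y1.
have := Cayley_Hamilton M.
rewrite Er (monicP (char_poly_monic M)) scale1r mul1r /y => ->.
by rewrite mulmx0; have [_ -> _ _] := linear_facts (El (coords h u x0)).
Qed.

End Morphisms.

(** * Invariant forms are represented by vectors *)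

Section Forms.
Context (R : realType) (P : lie_pair R) (X : cmodule P).
Context (h : X -> X -> R[i]).
Hypotheses (herm : is_hermitian_form h) (hpos : positive_definite h).

Lemma hermitian_inner_product : inner_product h.
Proof. by case: herm => [[_ hl _ _] hc]; split=> // y c x x'; apply: hl. Qed.

(** On the conjugate space the form with its arguments exchanged is linear in its
    first variable; orthonormal families are available there too. *)
Lemma conj_inner_product : inner_product (V := conj_module X) (fun x y => h y x).
Proof.
have hP := hermitian_inner_product; have [_ hc _] := hP.
by split=> // y c x x'; rewrite (inner_antir hP) conjK.
Qed.

Lemma hermitian_grp g (x y : X) : pgrp P g ->
  h (cgrp g x) (cgrp (conj_mx g) y) = h x y.
Proof. by case: herm => [[_ _ hg _] _] Bg; apply: hg. Qed.

Lemma hermitian_lie z (x y : X) : h (clie z x) y = - h x (clie (conjC_vec z) y).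
Proof.
by case: herm => [[_ _ _ hz] _]; apply/eqP; rewrite -addr_eq0; apply/eqP; apply: hz.
Qed.

Lemma grp_inv g (x : X) : pgrp P g -> pgrp P (invmx g) /\ cgrp (invmx g) (cgrp g x) = x.
Proof.
have [[Bu _ _ Bi] _] := pgrp_alg P; have [_ r1 rM _] := @cgrp_rational R P X.
move=> Bg; have Bi' := Bi _ Bg; split=> //.
by rewrite -rM// mulVmx ?r1//; apply: Bu.
Qed.

Lemma grp_invr g (x : X) : pgrp P g -> cgrp g (cgrp (invmx g) x) = x.
Proof.
have [[Bu _ _ Bi] _] := pgrp_alg P; have [_ r1 rM _] := @cgrp_rational R P X.
move=> Bg; have Bi' := Bi _ Bg.
by rewrite -rM// mulmxV ?r1//; apply: Bu.
Qed.

Lemma riesz_comb m (u : 'I_m -> X) (l : X -> R[i]) : orthonormal h u ->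
  linear (l : X -> R[i]^o) -> forall a : 'rV_m,
  l (comb u a) = h (comb u a) (comb u (\row_i conjc (l (u i)))).
Proof.
move=> ou ll a; have hP := hermitian_inner_product; have [_ hc _] := hP.
have [lD l0 _ lZ] := linear_facts ll.
rewrite {1}/comb (big_morph l lD l0) (innerZsum hP); apply: eq_bigr => i _.
rewrite hc; have /rowP/(_ i) := combK hP ou (\row_i conjc (l (u i))).
by rewrite !mxE => ->; rewrite conjK; apply: lZ.
Qed.

Context (b : X -> X -> R[i]).
Hypotheses (binv : invariant_bilinear_form b) (adm : admissible X).

Lemma form_grp_conj g x y : pgrp P g -> b x (cgrp g y) = b (cgrp (invmx g) x) y.
Proof.
by case: binv => _ _ bg _ Bg; rewrite -[in LHS](grp_invr x Bg) bg.
Qed.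

Lemma form_linearl y : linear (b^~ y : X -> R[i]^o).
Proof. by case: binv => _ bl _ _ c x x'; apply: bl. Qed.

(** Let W be a finite-dimensional stable subspace of the conjugate module
    containing y, and U the sum of the images of all the B-homomorphisms from W
    to X, finite-dimensional by admissibility.  If E is a finite-dimensional
    stable subspace of X, then representing b(-, v) on E by a vector of E, for v
    in W, is a B-homomorphism from W to E, so its values lie in U.  Taking E
    through x, for x orthogonal to U, gives b x v = 0.  Thus b(-, y) vanishes on
    the orthogonal complement of U and is represented by a vector of U. *)
Lemma form_representable y : exists y', forall x, b x y = h x y'.
Proof.
have hP := hermitian_inner_product; have hP' := conj_inner_product.
have [_ hc _] := hP; have [br bl bg bz] := binv.
have [m [u [su yu]]] := stable_family_through hP' y.
have [k [e [eB eG]]] := adm (subrep_rational hP' su).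
pose F A := \sum_j e j (row j (vec_mx A : 'M_(k, m))).
have lF : linear F.
  move=> c A B; rewrite /F scaler_sumr -big_split; apply: eq_bigr => j _ /=.
  by have [el _] := eB j; rewrite linearP linearP el.
pose U : set X := [set x | exists A, x = F A].
have [FD F0 _ FZ] := linear_facts lF.
have sU : subspace U.
  split=> [|c x z [A ->] [B ->]]; first by exists 0; rewrite F0.
  by exists (c *: A + B); rewrite lF.
have [n [w [ow wU Uw]]] := orthonormal_basis hP sU lF (fun x Ux => Ux).
have UB phi c : Bhom (V := 'rV_m) (subrep (X := conj_module X) (fun x y => h y x) u) phi ->
    U (phi c).
  move=> /eG[a ->]; exists (mxvec (\matrix_j (a j *: c))); apply: eq_bigr => j _.
  by rewrite mxvecK rowK; have [/linear_facts[_ _ _ ->] _] := eB j.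
have perp x : coords h w x = 0 -> b x y = 0.
  move=> xw.
  have xU v : U v -> h x v = 0.
    by move=> /Uw ->; apply: (inner_comb_eq0 hP).
  have [m' [u' [[ou' su'] xu']]] := stable_family_through hP x.
  pose cb (c : 'rV[R[i]]_m) : X := comb (V := conj_module X) u c.
  pose psi c : X := comb u' (\row_i conjc (b (u' i) (cb c))).
  have psiE a c : b (comb u' a) (cb c) = h (comb u' a) (psi c).
    exact: (riesz_comb ou' (form_linearl _)).
  (* psi sends v in W to the vector of E that represents b(-, v) on E. *)
  suff psiB : Bhom (V := 'rV_m) (subrep (X := conj_module X) (fun x y => h y x) u) psi.
    by rewrite yu xu' psiE -xu'; apply/xU/UB.
  split=> [c a a'|g Bg c].
    rewrite /psi -comb_linear; congr comb; apply/rowP => i.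
    rewrite !mxE /cb (@comb_linear R (conj_module X)) (br _ (conjc c)).
    by rewrite conjD conjM conjK.
  have [_ sgu] := comb_Bhom su.
  have Bg' := grp_conj (pgrp_alg P) Bg.
  have cbg : cb (subrep (X := conj_module X) (fun x y => h y x) u g c) = cgrp (conj_mx g) (cb c).
    exact: sgu.
  set d := psi _; set d' := cgrp g _.
  have dE a : h (comb u' a) d = h (comb u' a) d'.
    rewrite -psiE cbg form_grp_conj//; have [Bi _] := grp_inv x Bg'.
    rewrite su'// psiE -su'// -(hermitian_grp _ _ Bg') conj_mxK.
    by rewrite grp_invr.
  apply/eqP; rewrite -subr_eq0; apply/negPn/negP => /hpos.
  have [a ea] : exists a, d - d' = comb u' a.
    rewrite /d' /psi su'//;
    exists ((\row_i conjc (b (u' i)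
      (cb (subrep (X := conj_module X) (fun x y => h y x) u g c)))) - coords h u' (cgrp g (psi c))).
    by have [cD _ cN _] := linear_facts (comb_linear u'); rewrite cD cN.
  rewrite {1}ea -(addrC (- d')) -scaleN1r (inner_antir hP) dE conjN conj1 mulN1r addNr.
  by rewrite ltxx.
exists (comb w (\row_i conjc (b (w i) y))) => x.
have /perp := coords_residue hP ow x.
have := inner_comb_eq0 hP (\row_i conjc (b (w i) y)) (coords_residue hP ow x).
have [hD _ hN _] := linear_facts (inner_linearl hP (comb w (\row_i conjc (b (w i) y)))).
have [bD _ bN _] := linear_facts (form_linearl y).
rewrite hD hN bD bN => /eqP; rewrite subr_eq0 => /eqP -> /eqP; rewrite subr_eq0 => /eqP ->.
exact: (riesz_comb ow (form_linearl y)).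
Qed.

End Forms.

(** * Homomorphisms to the conjugate module *)

Section AntilinearMorphisms.
Context (R : realType) (P : lie_pair R) (X : cmodule P).
Implicit Types (J S : X -> X).

(** Seen on X itself, J is antilinear and carries the actions of g and z to those
    of their conjugates. *)
Definition conj_hom J : Prop := module_hom (Y := conj_module X) J.

Lemma conj_hom_linear J c x y : conj_hom J -> J (c *: x + y) = conjc c *: J x + J y.
Proof. by case=> Jl _ _; apply: Jl. Qed.

Lemma conj_homP J : conj_hom J ->
  [/\ {morph J : x y / x + y}, J 0 = 0, {morph J : x / - x} &
      forall c x, J (c *: x) = conjc c *: J x].
Proof. by case=> /linear_facts. Qed.

Lemma conj_hom_grp J g x : conj_hom J -> pgrp P g ->
  J (cgrp g x) = cgrp (conj_mx g) (J x).
Proof. by case=> _ Jg _ Bg; apply: (Jg g Bg x). Qed.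

Lemma conj_hom_lie J z x : conj_hom J -> J (clie z x) = clie (conjC_vec z) (J x).
Proof. by case=> _ _ Jz; apply: (Jz z x). Qed.

Lemma conj_hom_comp J S : conj_hom J -> conj_hom S -> module_hom (S \o J).
Proof.
move=> hJ hS; split=> [c x y|g Bg x|z x] /=.
- by rewrite (conj_hom_linear _ _ _ hJ) (conj_hom_linear _ _ _ hS) conjK.
- rewrite (conj_hom_grp _ hJ)// (conj_hom_grp _ hS) ?conj_mxK//.
  exact: (grp_conj (pgrp_alg P)).
- by rewrite (conj_hom_lie _ _ hJ) (conj_hom_lie _ _ hS) conjC_vecK.
Qed.

Lemma conj_hom_scale J c : conj_hom J -> conj_hom (fun x => c *: J x).
Proof.
move=> hJ; have := module_hom_scale (Y := conj_module X) (conjc c) hJ.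
rewrite /conj_hom; congr module_hom; apply/funext => x.
exact: (congr1 (fun d => d *: J x) (conjK c)).
Qed.

(** The representing vector of [form_representable] is unique, so its dependence
    on y inherits the invariance of b. *)
Lemma hom_of_form h (b : X -> X -> R[i]) :
  is_hermitian_form h -> positive_definite h -> admissible X ->
  invariant_bilinear_form b ->
  exists2 J, conj_hom J & forall x y, b x y = h x (J y).
Proof.
move=> herm hpos adm binv.
have hP := hermitian_inner_product herm hpos.
have [J bJ] := choice (form_representable herm hpos binv adm).
exists J => //; have [br _ _ bz] := binv.
split=> [c x y|g Bg x|z x]; apply: (inner_eq hP) => t.
- rewrite -bJ br !bJ; transitivity (conjc (conjc c) * h t (J x) + h t (J y)).
    by rewrite conjK.
  exact: esym (inner_antir hP _ _ _ _).
- rewrite -bJ (form_grp_conj binv)// bJ -(hermitian_grp herm _ _ Bg).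
  by rewrite grp_invr.
- have /eqP := bz z t x; rewrite -bJ addrC addr_eq0 => /eqP ->.
  by rewrite bJ (hermitian_lie herm) opprK.
Qed.

Lemma form_of_hom h J : is_hermitian_form h -> positive_definite h -> conj_hom J ->
  invariant_bilinear_form (fun x y => h x (J y)).
Proof.
move=> herm hpos hJ; have hP := hermitian_inner_product herm hpos.
split=> [x c y y'|y c x x'|g Bg x y|z x y].
- by rewrite (conj_hom_linear _ _ _ hJ) (inner_antir hP) conjK.
- exact: (inner_linearl hP).
- by rewrite (conj_hom_grp _ hJ)// (hermitian_grp herm).
- by rewrite (conj_hom_lie _ _ hJ) (hermitian_lie herm) addNr.
Qed.

Context (h : X -> X -> R[i]).
Hypotheses (herm : is_hermitian_form h) (hpos : positive_definite h).
Hypotheses (irr : irreducible X) (adm : admissible X).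

Let hP := hermitian_inner_product herm hpos.

Lemma conj_hom_inj J x : conj_hom J -> (exists y, J y != 0) -> x != 0 -> J x != 0.
Proof.
move=> hJ [y /eqP Jy] x0; apply/eqP => Jx; apply: Jy.
exact: (module_hom_ker irr hJ Jx x0).
Qed.

(** The scalar J o J commutes with J, and J is antilinear, so it is its own
    conjugate; it is not 0 because J is injective. *)
Lemma conj_hom_square J : conj_hom J -> (exists x, J x != 0) ->
  exists2 r : R, r != 0 & forall x, J (J x) = (r%:C)%C *: x.
Proof.
move=> hJ J0; have [c JJ] := schur hP irr adm (conj_hom_comp hJ hJ).
have [x nx] := J0; have [_ _ _ JZ] := conj_homP hJ.
have cc : conjc c = c.
  have : J (J (J x)) = c *: J x by apply: JJ.
  rewrite [J (J x)]JJ JZ => /eqP; rewrite -subr_eq0 -scalerBl scaler_eq0 (negPf nx) orbF.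
  by rewrite subr_eq0 => /eqP.
have cE : ((complex.Re c)%:C)%C = c.
  by case: (c) cc => a d [] /eqP; rewrite eqNr => /eqP ->.
exists (complex.Re c); last by move=> y; rewrite cE; apply: JJ.
apply/eqP => r0; have := conj_hom_inj hJ J0 nx.
by rewrite [J (J x)]JJ -cE r0 scale0r eqxx.
Qed.

(** S o J is a scalar c and J o J a real number r, so r S = S o J o J = c J. *)
Lemma conj_hom_unique J S : conj_hom J -> (exists x, J x != 0) -> conj_hom S ->
  exists c, forall x, S x = c *: J x.
Proof.
move=> hJ J0 hS; have [r r0 JJ] := conj_hom_square hJ J0.
have [c SJ] := schur hP irr adm (conj_hom_comp hJ hS).
have [_ _ _ SZ] := conj_homP hS.
have r0' : (r%:C)%C != 0 :> R[i] by rewrite (fmorph_eq0 (real_complex R)).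
exists ((r%:C)%C^-1 * c) => x; rewrite -scalerA -[c *: _](SJ (J x)) /= JJ SZ.
by rewrite conjc_real scalerA mulVf// scale1r.
Qed.

End AntilinearMorphisms.

(** * Endomorphisms over the real numbers *)

Section RealEndomorphisms.
Context (R : realType) (P : lie_pair R) (X : cmodule P).
Implicit Types (S T J : X -> X).

Definition real_endo T : Prop := @endomorphisms R P (res_module X) T.

Lemma mul_i_inj (x y : X) : 'i%C *: x = 'i%C *: y -> x = y.
Proof. by move/(congr1 (fun z => (- 'i%C) *: z)); rewrite !scalerA mulNr sqri opprK !scale1r. Qed.

Lemma real_endo_of_hom c S : conj_hom S -> real_endo (fun x => c *: x + S x).
Proof.
move=> hS; have [lin _ _ _] := @cgrp_rational R P X; have [zlin _ _] := @clie_action R P X.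
have [SD _ SN SZ] := conj_homP hS.
set T : X -> X := fun x => _.
have plT w : pl (clin (T : realify X -> realify X) w) = c *: pl w + S (mi w).
  rewrite /pl /mi /clin /T /= SD SN SZ conj_i scaleNr opprK !scalerDr addrACA.
  by rewrite !scalerA mulrC.
have miT w : mi (clin (T : realify X -> realify X) w) = c *: mi w + S (pl w).
  rewrite /pl /mi /clin /T /= SD SZ conj_i scaleNr scalerBr scalerDr opprD addrACA.
  by rewrite !scalerA mulrC.
split.
- move=> r x y; transitivity (c *: (r%:C *: x + y) + S (r%:C *: x + y)); first by [].
  rewrite (conj_hom_linear _ _ _ hS) conjc_real /T realifyE scalerDr.
  by rewrite (scalerDr r%:C) addrACA !scalerA mulrC.
- move=> z x; rewrite /= /res_lie /T (conj_hom_lie _ _ hS) conjC_vec_inC.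
  by rewrite zlin.
- move=> g Bg w; have Bg' := grp_conj (pgrp_alg P) Bg; apply: plmi_inj.
  + by rewrite plT !pl_back mi_back plT lin// (conj_hom_grp _ hS)// conj_mxK.
  + by rewrite miT !mi_back pl_back miT lin// (conj_hom_grp _ hS).
Qed.

(** The linear part is (T x - i T (i x)) / 2 and the antilinear one
    (T x + i T (i x)) / 2.  On the complexification X + conj X of the restriction,
    the first component of the extension of T is A u + B v at (u, v), and g acts
    by g on u and by its conjugate on v; taking v = 0 or u = 0 separates
    the equivariance of A from that of B. *)
Lemma real_endo_split T : real_endo T -> exists S1 S2,
  [/\ module_hom S1, conj_hom S2 & forall x, T x = S1 x + S2 x].
Proof.
case=> Tl Tz Tg; have [lin _ _ _] := @cgrp_rational R P X; have [zlin _ _] := @clie_action R P X.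
have [TD T0 TN TZ] := linear_facts Tl.
have TR (r : R) x : T (r%:C *: x) = r%:C *: T x by exact: TZ.
have TDX x y : T (x + y) = T x + T y by exact: TD.
have TNX x : T (- x) = - T x by exact: TN.
have T0X : T 0 = 0 by exact: T0.
pose S1 x := T x - 'i%C *: T ('i%C *: x).
pose S2 x := T x + 'i%C *: T ('i%C *: x).
pose half : R[i] := 2^-1.
have ii x : 'i%C *: ('i%C *: x) = - x :> X by rewrite scalerA sqri scaleN1r.
have addS (x y : X) : S1 (x + y) = S1 x + S1 y /\ S2 (x + y) = S2 x + S2 y.
  rewrite /S1 /S2 (scalerDr 'i%C x y) !TDX (scalerDr 'i%C (T _)) opprD.
  by split; rewrite addrACA.
have iS (x : X) : S1 ('i%C *: x) = 'i%C *: S1 x /\ S2 ('i%C *: x) = - ('i%C *: S2 x).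
  rewrite /S1 /S2 ii TNX scalerN opprK scalerBr scalerDr !ii opprK opprD opprK.
  by split; rewrite addrC.
have rS (r : R) (x : X) : S1 (r%:C *: x) = r%:C *: S1 x /\ S2 (r%:C *: x) = r%:C *: S2 x.
  have e : 'i%C *: (r%:C *: x) = r%:C *: ('i%C *: x) by rewrite !scalerA mulrC.
  by rewrite /S1 /S2 e !TR scalerBr scalerDr !scalerA (mulrC 'i%C).
have ZS c (x : X) : S1 (c *: x) = c *: S1 x /\ S2 (c *: x) = conjc c *: S2 x.
  case: c => a d; have e : a +i* d = a%:C + d%:C * 'i%C by rewrite [LHS]complexE mulrC.
  rewrite e conjD conjM !conjc_real conj_i !scalerDl -!scalerA.
  have [-> ->] := addS (a%:C *: x) (d%:C *: ('i%C *: x)).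
  have [-> ->] := rS a x; have [-> ->] := rS d ('i%C *: x); have [-> ->] := iS x.
  by rewrite scaleNr.
pose A x := half *: S1 x; pose B x := half *: S2 x.
have TE x : T x = A x + B x.
  by rewrite /A /B -scalerDr /S1 /S2 addrACA addNr addr0 half_sum.
have Al : linear A.
  move=> c x y; rewrite /A (proj1 (addS _ _)) (proj1 (ZS _ _)) scalerDr.
  by rewrite !scalerA mulrC.
have Bl c x y : B (c *: x + y) = conjc c *: B x + B y.
  rewrite /B (proj2 (addS _ _)) (proj2 (ZS _ _)) scalerDr.
  by rewrite !scalerA mulrC.
have [AD A0 AN AZ] := linear_facts Al.
have [BD B0 BN BZ] := linear_facts (Bl : linear (B : X -> conj_module X)).
have plT w : pl (clin (T : realify X -> realify X) w) = A (pl w) + B (mi w).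
  have BiN x : - B ('i%C *: x) = 'i%C *: B x.
    by have := Bl 'i%C x 0; rewrite B0 !addr0 => ->; rewrite conj_i scaleNr opprK.
  rewrite /pl /mi /clin /= !TE AD BD BN BiN AZ scalerDr addrACA.
  by [].
have gS g u v : pgrp P g ->
    A (cgrp g u) + B (cgrp (conj_mx g) v) = cgrp g (A u + B v).
  move=> Bg; have := congr1 (@pl R X) (Tg g Bg (back u v)).
  rewrite pl_back !plT pl_back mi_back => <-.
  by rewrite /= /res_grp pl_back mi_back pl_back mi_back.
have g0 g : pgrp P g -> cgrp (c := X) g 0 = 0.
  by move=> Bg; have [_ ->] := linear_facts (lin _ Bg).
have zS z (x : X) : A (clie (inC z) x) = clie (inC z) (A x) /\
                    B (clie (inC z) x) = clie (inC z) (B x).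
  have [zD _ zN zZ] := linear_facts (zlin (inC z)).
  have Tz' (y : X) : T (clie (inC z) y) = clie (inC z) (T y) by exact: Tz.
  by rewrite /A /B /S1 /S2 -zZ !Tz' zZ zD zZ zD zN zZ.
have lieE z (x : X) : clie z x = clie (inC z.1) x + 'i%C *: clie (inC z.2) x.
  have [_ l2 _] := @clie_action R P X; have [zD _ _ zZ] := linear_facts (l2 x).
  by rewrite {1}[z]cplxE zD zZ.
exists A, B; split; last exact: TE.
- split=> [//|g Bg x|z x].
  + have := gS g x 0 Bg; rewrite B0 addr0 => <-.
    by rewrite g0 ?B0 ?addr0//; apply: (grp_conj (pgrp_alg P)).
  + by rewrite lieE AD AZ !(proj1 (zS _ _)) [RHS]lieE.
- split=> [//|g Bg x|z x].
  + have Bg' := grp_conj (pgrp_alg P) Bg.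
    have := gS (conj_mx g) 0 x Bg'; rewrite g0// A0 !add0r conj_mxK.
    exact.
  + rewrite lieE BD BZ !(proj2 (zS _ _)).
    transitivity (clie (conjC_vec z) (B x)); last by [].
    rewrite (lieE (conjC_vec z)) /=.
    have [_ l2 _] := @clie_action R P X; have [_ _ zN _] := linear_facts (l2 (B x)).
    have -> : inC (- z.2) = - inC z.2 by congr pair; rewrite /= oppr0.
    rewrite zN scalerN; congr (_ + _).
    transitivity (conjc 'i%C *: (clie (inC z.2) (B x) : X)); first by [].
    by rewrite conj_i scaleNr.
Qed.

End RealEndomorphisms.

(** * The real endomorphism algebra and the sign of the form *)

Section Classification.
Context (R : realType) (P : lie_pair R) (X : cmodule P).
Context (h : X -> X -> R[i]).
Hypotheses (herm : is_hermitian_form h) (hpos : positive_definite h).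
Hypotheses (irr : irreducible X) (adm : admissible X).

Let hP := hermitian_inner_product herm hpos.

Lemma complex_of_no_conj_hom :
  (forall J : X -> X, conj_hom J -> forall x, J x = 0) -> is_complex X.
Proof.
move=> noJ; have [[x0 nx0] _] := irr.
have h0 : conj_hom ((fun=> 0) : X -> X) by exact: (module_hom0 X (conj_module X)).
exists (fun (c : Rcomplex R) (x : realify X) => (c : R[i]) *: (x : X) : realify X).
split.
- move=> r c d y; have -> : r *: c + d = (r%:C * (c : R[i]) + (d : R[i]) : R[i]).
    by case: c d => [a b] [a' b']; congr (_ +i* _); rewrite /=; ring.
  by rewrite scalerDl -scalerA.
- exact: scale1r.
- by move=> c d y; rewrite scalerA.
- move=> c d /(congr1 (@^~ x0)) e.
  have /eqP : (c : R[i]) *: x0 = (d : R[i]) *: x0 by exact: e.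
  by rewrite -subr_eq0 -scalerBl scaler_eq0 (negPf nx0) orbF subr_eq0 => /eqP.
- apply/seteqP; split=> [_ [c _ <-]|T /real_endo_split[S1 [S2 [hS1 hS2 TS]]]].
    have := real_endo_of_hom c h0; congr endomorphisms.
    by apply/funext => x; apply: (addr0 (c *: (x : X))).
  have [c Sc] := schur hP irr adm hS1.
  by exists c => //; apply/funext => x; rewrite TS Sc (noJ S2 hS2) addr0.
Qed.

Section WithStructure.
Context (J : X -> X) (hJ : conj_hom J) (J0 : exists x, J x != 0).

(** Evaluating at x and at i x separates the linear from the antilinear term. *)
Lemma comb_conj_eq0 c d : (forall x, c *: x + d *: J x = 0) -> c = 0 /\ d = 0.
Proof.
move=> cd; have [x nJx] := J0; have [_ Jz _ JZ] := conj_homP hJ.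
have nx : x != 0 by apply: contraNneq nJx => ->; rewrite Jz.
have e : c *: x - d *: J x = 0.
  apply: (@mul_i_inj _ _ X); rewrite scaler0 -[RHS](cd ('i%C *: x)) JZ conj_i.
  by rewrite scalerBr scaleNr scalerN !scalerA mulrC (mulrC d).
have c0 : c *: x = 0.
  have s0 : c *: x + c *: x = 0.
    by rewrite -[RHS](addr0 0) -{1}(cd x) -e addrACA subrr addr0.
  by rewrite -[LHS](half_sum (c *: x)) s0 scaler0.
split; apply/eqP.
  by move/eqP: c0; rewrite scaler_eq0 (negPf nx) orbF.
by have /eqP := cd x; rewrite c0 add0r scaler_eq0 (negPf nJx) orbF.
Qed.

Lemma real_endoP T : real_endo T <-> exists c d, forall x, T x = c *: x + d *: J x.
Proof.
split=> [/real_endo_split[S1 [S2 [hS1 hS2 TS]]]|[c [d Tcd]]].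
  have [c Sc] := schur hP irr adm hS1.
  have [d Sd] := conj_hom_unique herm hpos irr adm hJ J0 hS2.
  by exists c, d => x; rewrite TS Sc Sd.
have -> : T = (fun x => c *: x + d *: J x) by apply/funext.
exact: (real_endo_of_hom c (conj_hom_scale d hJ)).
Qed.

Lemma comb_conj_comp (r : R) (JJ : forall x, J (J x) = r%:C *: x) c d c' d' x :
  c *: (c' *: x + d' *: J x) + d *: J (c' *: x + d' *: J x) =
  (c * c' + r%:C * (d * conjc d')) *: x + (c * d' + d * conjc c') *: J x.
Proof.
have [JD _ _ JZ] := conj_homP hJ.
rewrite JD !JZ JJ !scalerDr !scalerA !scalerDl (addrC ((d * conjc c') *: J x)) addrACA.
by rewrite (mulrC r%:C) mulrA.
Qed.

(** The real matrix M, acting on C with basis 1, i, is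
    z |-> mxlin M * z + mxanti M * conj z; so matrices multiply like the
    c + d J with J o J = 1. *)
Definition mxlin (M : 'M[R]_2) : R[i] := ((M 0 0 + M 1 1) / 2) +i* ((M 1 0 - M 0 1) / 2).
Definition mxanti (M : 'M[R]_2) : R[i] := ((M 0 0 - M 1 1) / 2) +i* ((M 0 1 + M 1 0) / 2).

Lemma real_of_involution : (forall x, J (J x) = x) -> is_real X.
Proof.
move=> JJ; have JJ1 x : J (J x) = (1 : R)%:C *: x by rewrite scale1r.
pose phi (M : 'M[R]_2) (x : realify X) : realify X := mxlin M *: (x : X) + mxanti M *: J x.
have phiL r (M N : 'M[R]_2) :
    mxlin (r *: M + N) = r%:C * mxlin M + mxlin N /\
    mxanti (r *: M + N) = r%:C * mxanti M + mxanti N.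
  by split; apply/eqP; rewrite eq_complex /= !mxE; apply/andP; split; apply/eqP; field.
have phiM (M N : 'M[R]_2) :
    mxlin (M * N) = mxlin M * mxlin N + 1%:C * (mxanti M * conjc (mxanti N)) /\
    mxanti (M * N) = mxlin M * mxanti N + mxanti M * conjc (mxlin N).
  have E i j : (M * N) i j = M i 0 * N 0 j + M i 1 * N 1 j.
    by rewrite -mulmxE mxE !big_ord_recl big_ord0 addr0; congr (_ + M i _ * N _ j); apply/val_inj.
  by split; apply/eqP; rewrite eq_complex /= !E; apply/andP; split; apply/eqP; field.
exists phi; split.
- move=> r M N y; have [e1 e2] := phiL r M N; rewrite /phi e1 e2.
  transitivity (r%:C *: (mxlin M *: (y : X) + mxanti M *: J y)
    + (mxlin N *: (y : X) + mxanti N *: J y)).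
    by rewrite !scalerDl scalerDr !scalerA addrACA.
  by [].
- have [l1 a1] : mxlin 1 = 1 /\ mxanti 1 = 0.
    by split; apply/eqP; rewrite eq_complex /= !mxE /=; apply/andP; split; apply/eqP; field.
  move=> y; rewrite /phi l1 a1; transitivity (1 *: (y : X) + 0 *: J y); first by [].
  by rewrite scale1r scale0r addr0.
- move=> M N y; have [e1 e2] := phiM M N.
  by rewrite /phi e1 e2 -(comb_conj_comp JJ1).
- move=> M N MN.
  have [M0 A0] : mxlin ((-1) *: N + M) = 0 /\ mxanti ((-1) *: N + M) = 0.
    apply: comb_conj_eq0 => x; have [-> ->] := phiL (-1) N M.
    have := congr1 (@^~ x) MN; rewrite /phi => e.
    rewrite (_ : (-1)%:C = -1) ?rmorphN ?rmorph1// !mulN1r !scalerDl !scaleNr addrACA.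
    by rewrite e -opprD addNr.
  have : (-1) *: N + M = 0; last by rewrite scaleN1r addrC => /eqP; rewrite subr_eq0 => /eqP.
  move: M0 A0; move: (_ + _) => Q /eqP; rewrite eq_complex /= => /andP[/eqP q1 /eqP q2].
  move=> /eqP; rewrite eq_complex /= => /andP[/eqP q3 /eqP q4].
  have [e00 e11] : Q 0 0 = 0 /\ Q 1 1 = 0 by split; lra.
  have [e01 e10] : Q 0 1 = 0 /\ Q 1 0 = 0 by split; lra.
  have I2 (i : 'I_2) : i = 0 \/ i = 1.
    by case: i => [[|[|//]] ?]; [left|right]; apply: val_inj.
  apply/matrixP => i j; rewrite mxE.
  by case: (I2 i) => ->; case: (I2 j) => ->.
- apply/seteqP; split=> [_ [M _ <-]|T].
    by apply/real_endoP; exists (mxlin M), (mxanti M).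
  move=> /real_endoP[[c1 c2] [[d1 d2] Tcd]].
  pose M : 'M[R]_2 := \matrix_(i, j) if i == 0 then if j == 0 then c1 + d1 else d2 - c2
                         else if j == 0 then c2 + d2 else c1 - d1.
  exists M => //; apply/funext => x; rewrite Tcd /phi.
  have -> : mxlin M = c1 +i* c2.
    by apply/eqP; rewrite eq_complex /= !mxE /=; apply/andP; split; apply/eqP; field.
  have -> // : mxanti M = d1 +i* d2.
  by apply/eqP; rewrite eq_complex /= !mxE /=; apply/andP; split; apply/eqP; field.
Qed.

(** The quaternion units are i, J and i J; the inverse of c + d J is
    (conj c - d J) / (|c|^2 + |d|^2). *)
Lemma quaternionic_of_antiinvolution : (forall x, J (J x) = - x) -> is_quaternionic X.
Proof.
move=> JJ; have JJ1 x : J (J x) = (-1 : R)%:C *: x.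
  by rewrite rmorphN rmorph1 scaleN1r.
have [JD Jz JN JZ] := conj_homP hJ.
have [[x0 nx0] _] := irr.
have expand c0 c1 c2 c3 (x : X) :
    (c0 +i* c1) *: x + (c2 +i* c3) *: J x =
    c0%:C *: x + c1%:C *: ('i%C *: x) + c2%:C *: J x + c3%:C *: ('i%C *: J x).
  rewrite [c0 +i* c1]complexE [c2 +i* c3]complexE /= !scalerDl !(mulrC 'i%C).
  by rewrite -!scalerA addrA.
split.
  exists (-1), (-1), (fun x : X => 'i%C *: x), J.
  split.
  - by rewrite oppr_eq0 oner_eq0.
  - split; apply/real_endoP; first by exists 'i%C, 0 => x; rewrite scale0r addr0.
    by exists 0, 1 => x; rewrite scale0r add0r scale1r.
  - split=> y; last by rewrite JZ conj_i scaleNr.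
      by rewrite scalerA sqri; rewrite realifyE rmorphN rmorph1.
    exact: JJ1.
  - move=> T /real_endoP[[c0 c1] [[c2 c3] Tcd]]; exists c0, c1, c2, c3 => y.
    by rewrite Tcd expand.
  - move=> c0 c1 c2 c3 e; have [] := @comb_conj_eq0 (c0 +i* c1) (c2 +i* c3).
      by move=> x; rewrite expand; apply: e.
    by move=> [-> ->] [-> ->].
move=> T /real_endoP[c [d Tcd]] [y Ty].
pose n := c * conjc c + d * conjc d.
have n0 : n != 0.
  have ge0 (z : R[i]) : 0 <= z * conjc z by exact: mul_conjC_ge0.
  have eq0 (z : R[i]) : (z * conjc z == 0) = (z == 0) by exact: mul_conjC_eq0.
  rewrite paddr_eq0// !eq0; apply: contra Ty => /andP[/eqP c0 /eqP d0].
  by rewrite Tcd c0 d0 !scale0r addr0.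
have ncc : conjc n = n by rewrite /n conjD !conjM !conjK (mulrC c) (mulrC d).
pose c' : R[i] := conjc c / n; pose d' : R[i] := - (d / n).
exists (fun x => c' *: x + d' *: J x).
have Tcd' x : T x = c *: (x : X) + d *: J x by apply: Tcd.
have Jinv : (-1 : R)%:C = -1 by rewrite rmorphN rmorph1.
have cni : conjc n^-1 = n^-1 by rewrite -{2}ncc; apply: conjc_inv.
have cc' : conjc c' = c / n by rewrite /c' conjM conjK cni.
have cd' : conjc d' = - (conjc d / n) by rewrite /d' conjN conjM cni.
have nV : (c * conjc c + d * conjc d) / n = 1 by apply: mulfV.
have lin1 : c * c' + -1 * (d * conjc d') = 1 by rewrite cd' /c' -[RHS]nV; ring.
have anti1 : c * d' + d * conjc c' = 0 by rewrite cc' /d'; ring.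
have lin2 : c' * c + -1 * (d' * conjc d) = 1 by rewrite /c' /d' -[RHS]nV; ring.
have anti2 : c' * d + d' * conjc c = 0 by rewrite /c' /d'; ring.
have one_zero (x : X) : 1 *: x + 0 *: J x = x by rewrite scale1r scale0r addr0.
split=> [|x|x].
- by apply/real_endoP; exists c', d'.
- by rewrite Tcd' (comb_conj_comp JJ1) Jinv lin1 anti1; apply: one_zero.
- rewrite Tcd' (comb_conj_comp JJ1) Jinv lin2 anti2; apply: one_zero.
Qed.

End WithStructure.

(** Dividing J by sqrt |r| divides J o J by |r|. *)
Lemma conj_hom_normalise (J : X -> X) (r : R) : conj_hom J -> (exists x, J x != 0) -> r != 0 ->
  (forall x, J (J x) = r%:C *: x) ->
  exists J' : X -> X, [/\ conj_hom J', exists x, J' x != 0 &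
    forall x, J' (J' x) = (Num.sg r)%:C *: x].
Proof.
move=> hJ [x nx] r0 JJ; have [_ _ _ JZ] := conj_homP hJ.
pose s := (Num.sqrt `|r|)^-1.
have s0 : s != 0 by rewrite invr_eq0 gt_eqF// sqrtr_gt0 normr_gt0.
have s2 : s * s * r = Num.sg r.
  rewrite -invfM -expr2 sqr_sqrtr ?normr_ge0// [X in _ * X]numEsg mulrCA.
  by rewrite mulVf ?mulr1// normr_eq0.
exists (fun x => s%:C *: J x); split.
- exact: conj_hom_scale.
- by exists x; rewrite scaler_eq0 (negPf nx) orbF (fmorph_eq0 (real_complex R)).
- by move=> y; rewrite JZ conjc_real JJ !scalerA -s2 !rmorphM mulrA.
Qed.

Lemma real_of_square_gt0 (J : X -> X) (r : R) : conj_hom J -> (exists x, J x != 0) -> 0 < r ->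
  (forall x, J (J x) = r%:C *: x) -> is_real X.
Proof.
move=> hJ J0 r0 JJ.
have [|J' [hJ' J0' JJ']] := conj_hom_normalise hJ J0 _ JJ; first by rewrite gt_eqF.
apply: (real_of_involution hJ' J0') => x.
by rewrite JJ' gtr0_sg// scale1r.
Qed.

Lemma quaternionic_of_square_lt0 (J : X -> X) (r : R) : conj_hom J -> (exists x, J x != 0) ->
  r < 0 ->
  (forall x, J (J x) = r%:C *: x) -> is_quaternionic X.
Proof.
move=> hJ J0 r0 JJ.
have [|J' [hJ' J0' JJ']] := conj_hom_normalise hJ J0 _ JJ; first by rewrite lt_eqF.
apply: (quaternionic_of_antiinvolution hJ' J0') => x.
by rewrite JJ' ltr0_sg// rmorphN rmorph1 scaleN1r.
Qed.

Lemma invariant_form_swap (b : X -> X -> R[i]) : invariant_bilinear_form b ->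
  invariant_bilinear_form (fun x y => b y x).
Proof.
case=> br bl bg bz; split=> [x c y y'|y c x x'|g Bg x y|z x y].
- exact: bl.
- exact: br.
- exact: bg.
- by rewrite addrC bz.
Qed.

(** With b x y = h x (J y) and b y x = h x (S y), uniqueness gives S = d J, so
    exchanging the arguments multiplies b by conj d, whose square is 1.  The
    identity [key] below compares two positive numbers and shows that conj d has
    the sign of J o J. *)
Lemma form_sign (b : X -> X -> R[i]) : invariant_bilinear_form b -> nonzero_form b ->
  (is_symmetric_form b /\ is_real X) \/ (is_antisymmetric_form b /\ is_quaternionic X).
Proof.
move=> binv [x1 [y1 nb]].
have [J hJ bJ] := hom_of_form herm hpos adm binv.
have [S hS bS] := hom_of_form herm hpos adm (invariant_form_swap binv).
have nJ : J y1 != 0 by apply: contraNneq nb => e; rewrite bJ e (inner_0r hP).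
have J0 : exists x, J x != 0 by exists y1.
have [d SJ] := conj_hom_unique herm hpos irr adm hJ J0 hS.
have swap x y : b y x = conjc d * b x y by rewrite bS SJ (inner_Zr hP) bJ.
have [r r0 JJ] := conj_hom_square herm hpos irr adm hJ J0.
have d2 : conjc d * conjc d = 1.
  apply: (mulIf nb); rewrite mul1r [in RHS](swap y1 x1) (swap x1 y1).
  by rewrite mulrA.
have ny1 : y1 != 0 by apply: contraNneq nJ => ->; have [_ -> _ _] := conj_homP hJ.
have pos1 : 0 < h (J y1) (J y1) by apply: hpos.
have pos2 : 0 < h y1 y1 by apply: hpos.
have key : h (J y1) (J y1) = conjc d * (r%:C * h y1 y1).
  by rewrite -bJ swap bJ JJ (inner_Zr hP) conjc_real.
have posr (t : R) : 0 < t%:C * h y1 y1 -> 0 < t.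
  by rewrite pmulr_lgt0// ltcR.
have /eqP : conjc d ^+ 2 = 1 by rewrite expr2.
rewrite sqrf_eq1 => /orP[/eqP d1|/eqP d1]; [left|right]; split.
- by move=> x y; rewrite swap d1 mul1r.
- apply: (real_of_square_gt0 hJ J0 _ JJ); apply: posr.
  by rewrite -[X in 0 < X]mul1r -d1 -key.
- by move=> x y; rewrite swap d1 mulN1r.
- apply: (quaternionic_of_square_lt0 hJ J0 _ JJ); rewrite -oppr_gt0; apply: posr.
  by rewrite rmorphN mulNr -mulN1r -d1 -key.
Qed.

Lemma exists_form_or_no_conj_hom :
  (exists b : X -> X -> R[i], invariant_bilinear_form b /\ nonzero_form b) \/
  (forall J : X -> X, conj_hom J -> forall x, J x = 0).
Proof.
have [[J [x [hJ Jx]]]|noJ] := pselect (exists (J : X -> X) x, conj_hom J /\ J x != 0).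
  left; exists (fun x y => h x (J y)); split; first exact: form_of_hom.
  by exists (J x), x; rewrite gt_eqF// hpos.
right=> J hJ x; apply/eqP/negPn/negP => Jx; apply: noJ.
by exists J, x.
Qed.

End Classification.

Theorem theorem5p12 (R : realType) (P : lie_pair R) (X : cmodule P)
    (hQ : conditionQ P) (hirr : irreducible X) (hadm : admissible X)
    (hunit : infinitesimally_unitary X) :
  exists e : int,
    [/\ FS_R X e,
        e <> 0 <-> (exists b : X -> X -> R[i], invariant_bilinear_form b /\ nonzero_form b) &
        forall b : X -> X -> R[i], invariant_bilinear_form b -> nonzero_form b ->
          (is_real X <-> is_symmetric_form b) /\
          (is_quaternionic X <-> is_antisymmetric_form b)].
Proof.
have [h [herm hpos]] := hunit.
have sign := form_sign herm hpos hirr hadm.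
have rq := @real_not_quaternionic R P X.
have excl (b : X -> X -> R[i]) :
    nonzero_form b -> is_symmetric_form b -> is_antisymmetric_form b -> False.
  move=> [x [y /eqP nb]] bs ba; apply: nb; have := bs x y; rewrite ba => /eqP.
  by rewrite -subr_eq0 -opprD oppr_eq0 -mulr2n mulrn_eq0 => /eqP.
have part3 (b : X -> X -> R[i]) : invariant_bilinear_form b -> nonzero_form b ->
    (is_real X <-> is_symmetric_form b) /\ (is_quaternionic X <-> is_antisymmetric_form b).
  move=> binv nb; have ex := excl b nb.
  by case: (sign b binv nb) => -[? ?]; tauto.
have [[b [binv nb]]|noJ] := exists_form_or_no_conj_hom herm hpos.
  have [e e0 FSe] : exists2 e : int, e <> 0 & FS_R X e.
    by case: (sign b binv nb) => -[_ ?]; [exists 1|exists (-1)] => //; [apply: Or31|apply: Or33].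
  by exists e; split=> //; split=> // _; exists b.
exists 0; split=> //.
  by apply: Or32; split=> //; apply: (complex_of_no_conj_hom herm hpos hirr hadm noJ).
split=> // -[b [binv [x [y /eqP nb]]]]; exfalso; apply: nb.
have [J hJ ->] := hom_of_form herm hpos hadm binv.
by rewrite (noJ J hJ) (inner_0r (hermitian_inner_product herm hpos)).
Qed.
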